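(* Let $d,r\ge2$ and $e\ge1$. Consider the presentation with generators $\{z\}\cup\{t_i\mid i\in\mathbb{Z}\}\cup S$, $S=\{s_3,\ldots,s_r\}$, and relations: the usual braid relations on $S$; $t_it_{i-1}=t_jt_{j-1}$ for $i,j\in\mathbb{Z}$; $s_3t_is_3=t_is_3t_i$ for $i\in\mathbb{Z}$; $s_jt_i=t_is_j$ for $i\in\mathbb{Z}$, $4\le j\le r$; $zt_i=t_{i-e}z$ for $i\in\mathbb{Z}$; $zs_j=s_jz$ for $3\le j\le r$. Let $B(de,e,r)$ be the group, and $B^+(de,e,r)$ the monoid, defined by this presentation. Then this presentation gives rise to a quasi-Garside structure on $B(de,e,r)\cong C_\infty^e\ltimes B(\infty,\infty,r)$, where $B^+(de,e,r)\cong (C_\infty^e)^+\ltimes B^+(\infty,\infty,r)$ is the quasi-Garside monoid (with group of fractions $B(de,e,r)$) and $z\Lambda$ is a Garside element, where $$\Lambda=(s_rs_{r-1}\cdots s_3\,t_1t_0)^{r-1}.$$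
   Context: The usual braid relations on $S=\{s_3,\ldots,s_r\}$ are $s_is_j=s_js_i$ for $|i-j|\ge 2$ and $s_is_{i+1}s_i=s_{i+1}s_is_{i+1}$ for $3\le i\le r-1$. If $r=2$ then $S=\emptyset$, all relations involving some $s_j$ are absent, and $s_r\cdots s_3$ is the empty product. The group with the stated presentation is the braid group $B(de,e,r)$ of the complex reflection group $G(de,e,r)$ (it does not depend on $d\ge2$). $B(\infty,\infty,r)$ and $B^+(\infty,\infty,r)$ are the group and the monoid defined by the generators $\{t_i\mid i\in\mathbb{Z}\}\cup S$ and the relations: the usual braid relations on $S$; $t_it_{i-1}=t_jt_{j-1}$ for $i,j\in\mathbb{Z}$; $s_3t_is_3=t_is_3t_i$ for $i\in\mathbb{Z}$; $s_jt_i=t_is_j$ for $i\in\mathbb{Z}$, $4\le j\le r$. $C_\infty^e=\langle z\rangle$ is an infinite cyclic group, $(C_\infty^e)^+=\{z^n\mid n\ge0\}$, and $z$ acts on $B(\infty,\infty,r)$ and $B^+(\infty,\infty,r)$ by $zt_iz^{-1}=t_{i-e}$, $zs_jz^{-1}=s_j$. A monoid $M$ is quasi-Garside if: (1) $M$ is atomic, i.e. for every $m\in M$ the number of (nontrivial) factors in a product equal to $m$ is bounded; (2) $M$ is left- and right-cancellative; (3) $M$ is a lattice with respect to each of the orders defined by left divisibility and by right divisibility; (4) $M$ has a Garside element $\Delta$, i.e. an element whose set of left divisors equals its set of right divisors, this set generating $M$. A quasi-Garside monoid satisfies Ore's conditions and so embeds in its group of fractions $G$; the pair $(M,\Delta)$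 is called a quasi-Garside structure on $G$. *)

(* Defs.v *)
From HB Require Import structures.
From mathcomp Require Import all_boot ssralg ssrint.
From mathcomp Require Import boolp.

Set Implicit Arguments.
Unset Strict Implicit.
Unset Printing Implicit Defensive.

Local Open Scope group_scope.
Local Open Scope quotient_scope.

Section QuasiGarside.
Variable M : monoidType.
Implicit Types a b c m D : M.

Definition ldivides a b := exists c, b = a * c.
Definition rdivides a b := exists c, b = c * a.

Definition atomic := forall m, exists n : nat, forall s : seq M,
  (forall x, x \in s -> x <> 1) -> \prod_(x <- s) x = m -> size s <= n.

Definition cancellative :=
  right_injective ( *%g : M -> M -> M) /\ left_injective ( *%g : M -> M -> M).

Definition garside_element D :=
  (forall a, ldivides a D <-> rdivides a D) /\
  (forall m, exists2 s : seq M,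
     forall x, x \in s -> ldivides x D & m = \prod_(x <- s) x).

End QuasiGarside.

Section Lattice.
Variables (T : Type) (le : T -> T -> Prop).

Definition partial_order :=
  [/\ forall x, le x x,
      forall x y z, le x y -> le y z -> le x z &
      forall x y, le x y -> le y x -> x = y].

Definition is_meet x y m :=
  [/\ le m x, le m y & forall w, le w x -> le w y -> le w m].

Definition is_join x y j :=
  [/\ le x j, le y j & forall w, le x w -> le y w -> le j w].

Definition lattice_order :=
  [/\ partial_order,
      forall x y, exists m, is_meet x y m &
      forall x y, exists j, is_join x y j].

End Lattice.

Definition quasi_garside (M : monoidType) :=
  [/\ atomic M, cancellative M,
      lattice_order (@ldivides M) /\ lattice_order (@rdivides M) &
      exists D : M, garside_element D].

Definition group_of_fractions (M : monoidType) (G : groupType) (f : M -> G) :=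
  [/\ monoid_morphism f, injective f,
      forall g, exists a b, g = f a / f b &
      forall g, exists a b, g = (f a)^-1 * f b].

Definition quasi_garside_structure (M : monoidType) (G : groupType)
    (f : M -> G) (D : M) :=
  [/\ quasi_garside M, garside_element D & group_of_fractions f].

Definition isomorphism (M N : monoidType) (f : M -> N) :=
  monoid_morphism f /\ bijective f.

Section PresentedMonoid.
Variables (X : choiceType) (R : seq X -> seq X -> Prop).

Inductive pcong : seq X -> seq X -> Prop :=
| pcong_rel a u v b of R u v : pcong (a ++ u ++ b) (a ++ v ++ b)
| pcong_refl u : pcong u u
| pcong_sym u v of pcong u v : pcong v u
| pcong_trans u v w of pcong u v & pcong v w : pcong u w.

Lemma pcong_catl a u v : pcong u v -> pcong (a ++ u) (a ++ v).
Proof.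
elim=> [c u0 v0 b Ruv|w|u0 v0 _|u0 v0 w _ IH1 _ IH2].
- by rewrite !(catA a); exact: pcong_rel.
- exact: pcong_refl.
- exact: pcong_sym.
- exact: pcong_trans IH1 IH2.
Qed.

Lemma pcong_catr a u v : pcong u v -> pcong (u ++ a) (v ++ a).
Proof.
elim=> [c u0 v0 b Ruv|w|u0 v0 _|u0 v0 w _ IH1 _ IH2].
- by rewrite -!catA; exact: pcong_rel.
- exact: pcong_refl.
- exact: pcong_sym.
- exact: pcong_trans IH1 IH2.
Qed.

Lemma pcong_cat u u' v v' : pcong u u' -> pcong v v' ->
  pcong (u ++ v) (u' ++ v').
Proof.
by move=> uu' vv'; apply: pcong_trans (pcong_catr _ uu') (pcong_catl _ vv').
Qed.

Definition pcongb u v := `[< pcong u v >].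

Lemma pcongb_equiv : equiv_class_of pcongb.
Proof.
split.
- by move=> u; apply/asboolP; exact: pcong_refl.
- by move=> u v; apply/asboolP/asboolP; exact: pcong_sym.
- by move=> v u w /asboolP uv /asboolP vw; apply/asboolP/(pcong_trans uv vw).
Qed.

Canonical pcong_equiv := EquivRelPack pcongb_equiv.

Definition pres_mon := {eq_quot pcong_equiv}.

HB.instance Definition _ := Choice.on pres_mon.

Definition pword (w : seq X) : pres_mon := \pi_({eq_quot pcong_equiv}) w.

Definition pgen (x : X) : pres_mon := pword [:: x].

Lemma pwordP u v : pword u = pword v <-> pcong u v.
Proof.
split=> [/eqquotP/asboolP //|uv].
by apply/eqquotP/asboolP.
Qed.

Lemma pword_repr (m : pres_mon) : pword (repr m) = m.
Proof. by rewrite /pword reprK. Qed.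

Definition pmul (a b : pres_mon) : pres_mon := pword (repr a ++ repr b).
Definition pone : pres_mon := pword [::].

Lemma pmul_word u v : pmul (pword u) (pword v) = pword (u ++ v).
Proof. by apply/pwordP/pcong_cat; apply/pwordP; rewrite pword_repr. Qed.

Lemma pmulA : associative pmul.
Proof.
move=> a b c; rewrite -(pword_repr a) -(pword_repr b) -(pword_repr c).
by rewrite !pmul_word catA.
Qed.

Lemma pmul1 : left_id pone pmul.
Proof. by move=> a; rewrite -(pword_repr a) pmul_word. Qed.

Lemma pmulr1 : right_id pone pmul.
Proof. by move=> a; rewrite -(pword_repr a) pmul_word cats0. Qed.

HB.instance Definition _ := isMonoid.Build pres_mon pmulA pmul1 pmulr1.

Lemma pword_cat u v : pword (u ++ v) = pword u * pword v.
Proof. by rewrite [RHS]pmul_word. Qed.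

Lemma pword_prod w : pword w = \prod_(x <- w) pgen x.
Proof.
elim: w => [|x w IHw]; first by rewrite big_nil.
by rewrite big_cons -IHw -pword_cat.
Qed.

(* The map induced by [f] when [f] respects the relations [R]; see
   [pliftE], [plift_morphism]. *)
Definition plift (N : monoidType) (f : X -> N) (m : pres_mon) : N :=
  \prod_(x <- repr m) f x.

Section Lift.
Variables (N : monoidType) (f : X -> N).
Hypothesis fR :
  forall u v, R u v -> \prod_(x <- u) f x = \prod_(x <- v) f x.

Lemma prod_pcong u v :
  pcong u v -> \prod_(x <- u) f x = \prod_(x <- v) f x.
Proof.
by elim=> [a u0 v0 b /fR e|//|//|u0 v0 w _ -> _ -> //]; rewrite !big_cat /= e.
Qed.

Lemma plift_word w : plift f (pword w) = \prod_(x <- w) f x.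
Proof. by apply: prod_pcong; apply/pwordP; rewrite pword_repr. Qed.

Lemma pliftE x : plift f (pgen x) = f x.
Proof. by rewrite plift_word big_seq1. Qed.

Lemma plift_morphism : monoid_morphism (plift f).
Proof.
split=> [|a b]; first by rewrite plift_word big_nil.
rewrite -(pword_repr a) -(pword_repr b) -pword_cat !plift_word.
by rewrite big_cat.
Qed.

End Lift.

Lemma pres_mon_ext (N : monoidType) (f g : pres_mon -> N) :
  monoid_morphism f -> monoid_morphism g ->
  (forall x, f (pgen x) = g (pgen x)) -> f =1 g.
Proof.
move=> [f1 fM] [g1 gM] fg m; rewrite -(pword_repr m).
elim: (repr m) => [|x w IHw]; first by rewrite [pword _]/(1 : pres_mon) f1 g1.
by rewrite (pword_cat [:: x]) fM gM IHw fg.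
Qed.

End PresentedMonoid.

Section PresentedGroup.
Variables (X : choiceType) (R : seq X -> seq X -> Prop).

(* [(x, true)] is the letter [x] and [(x, false)] its formal inverse. *)
Inductive grp_rel : seq (X * bool) -> seq (X * bool) -> Prop :=
| grp_rel_pos u v of R u v :
    grp_rel [seq (x, true) | x <- u] [seq (x, true) | x <- v]
| grp_rel_inv x b : grp_rel [:: (x, b); (x, ~~ b)] [::].

Definition pres_grp := pres_mon grp_rel.

HB.instance Definition _ := Monoid.on pres_grp.

Definition pgword (w : seq (X * bool)) : pres_grp := pword grp_rel w.

Definition ginv_word (w : seq (X * bool)) := rev [seq (l.1, ~~ l.2) | l <- w].

Definition pginv (g : pres_grp) : pres_grp := pgword (ginv_word (repr g)).

Lemma ginv_wordK : involutive ginv_word.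
Proof.
move=> w; rewrite /ginv_word map_rev revK -map_comp map_id_in //.
by move=> [x b] _ /=; rewrite negbK.
Qed.

Lemma ginv_wordr w : pcong grp_rel (w ++ ginv_word w) [::].
Proof.
elim: w => [|[x b] w IHw]; first exact: pcong_refl.
rewrite /ginv_word map_cons rev_cons -/(ginv_word w) -cats1 /=.
have h := pcong_catl [:: (x, b)] (pcong_catr [:: (x, ~~ b)] IHw).
rewrite /= -catA in h; apply: pcong_trans h _.
by have := pcong_rel [::] [::] (grp_rel_inv x b).
Qed.

Lemma ginv_wordl w : pcong grp_rel (ginv_word w ++ w) [::].
Proof. by rewrite -[w in _ ++ w]ginv_wordK; exact: ginv_wordr. Qed.

Lemma pmulgV : right_inverse 1 pginv ( *%g : pres_grp -> pres_grp -> pres_grp).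
Proof.
move=> g; rewrite /pginv /pgword -{1}(pword_repr g) -pword_cat.
exact/pwordP/ginv_wordr.
Qed.

Lemma pmulVg : left_inverse 1 pginv ( *%g : pres_grp -> pres_grp -> pres_grp).
Proof.
move=> g; rewrite /pginv /pgword -{2}(pword_repr g) -pword_cat.
exact/pwordP/ginv_wordl.
Qed.

HB.instance Definition _ := hasInv.Build pres_grp pginv.
HB.instance Definition _ := Monoid_isGroup.Build pres_grp pmulVg pmulgV.

Definition pggen (x : X) : pres_grp := pgword [:: (x, true)].

Lemma pggenV x : (pggen x)^-1 = pgword [:: (x, false)].
Proof.
apply: (mulgI (pggen x)); rewrite mulgV -[RHS]pword_cat.
apply/esym/pwordP; exact: (pcong_rel [::] [::] (grp_rel_inv x true)).
Qed.

Lemma pggen_rel u v :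
  R u v -> \prod_(x <- u) pggen x = \prod_(x <- v) pggen x.
Proof.
have E w : \prod_(x <- w) pggen x = pgword [seq (x, true) | x <- w].
  by rewrite [RHS]pword_prod big_map.
move=> Ruv; rewrite !E; apply/pwordP.
have := pcong_rel [::] [::] (grp_rel_pos Ruv).
by rewrite /= !cats0.
Qed.

Definition mon_to_grp : pres_mon R -> pres_grp := plift pggen.

Lemma mon_to_grpE x : mon_to_grp (pgen R x) = pggen x.
Proof. exact: (pliftE pggen_rel). Qed.

Lemma mon_to_grp_morphism : monoid_morphism mon_to_grp.
Proof. exact: (plift_morphism pggen_rel). Qed.

Definition gletter (H : groupType) (f : X -> H) (l : X * bool) : H :=
  if l.2 then f l.1 else (f l.1)^-1.

(* The map induced by [f] when [f] respects the relations [R]; see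
   [pgliftE], [pglift_morphism]. *)
Definition pglift (H : groupType) (f : X -> H) : pres_grp -> H :=
  plift (gletter f).

Section Lift.
Variables (H : groupType) (f : X -> H).
Hypothesis fR :
  forall u v, R u v -> \prod_(x <- u) f x = \prod_(x <- v) f x.

Lemma gletter_rel u v :
  grp_rel u v -> \prod_(l <- u) gletter f l = \prod_(l <- v) gletter f l.
Proof.
case=> [u0 v0 /fR e|x b]; first by rewrite !big_map.
by rewrite !big_cons !big_nil mulg1 /gletter /=; case: b => /=;
   rewrite ?mulgV ?mulVg.
Qed.

Lemma pgliftE x : pglift f (pggen x) = f x.
Proof. exact: (pliftE gletter_rel). Qed.

Lemma pglift_morphism : monoid_morphism (pglift f).
Proof. exact: (plift_morphism gletter_rel). Qed.

End Lift.

Lemma pres_grp_ext (H : groupType) (f g : pres_grp -> H) :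
  monoid_morphism f -> monoid_morphism g ->
  (forall x, f (pggen x) = g (pggen x)) -> f =1 g.
Proof.
move=> fm gm fg; apply: pres_mon_ext => // -[x []]; first exact: fg.
have V (h : pres_grp -> H) : monoid_morphism h ->
    h (pgword [:: (x, false)]) = (h (pggen x))^-1.
  move=> [h1 hM]; apply: (mulgI (h (pggen x))).
  by rewrite mulgV -hM -pggenV mulgV h1.
by rewrite [LHS]V // [RHS]V // fg.
Qed.

End PresentedGroup.

Record monoid_action (C B : monoidType) := MonoidAction {
  mact :> C -> B -> B;
  mact1 : forall b, mact 1 b = b;
  mactM : forall c c' b, mact (c * c') b = mact c (mact c' b);
  mact_morphism : forall c, monoid_morphism (mact c)
}.

(* [(c, b)] stands for the product [b c], where [c b c^-1 = a c b]. *)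
Definition semidirect (C B : monoidType) (a : monoid_action C B) : Type :=
  (C * B)%type.

Section SemidirectMonoid.
Variables (C B : monoidType) (a : monoid_action C B).

HB.instance Definition _ := Choice.copy (semidirect a) (C * B)%type.

Definition sdpair (c : C) (b : B) : semidirect a := (c, b).

Definition sdmul (x y : semidirect a) : semidirect a :=
  (x.1 * y.1, x.2 * a x.1 y.2).
Definition sdone : semidirect a := (1, 1).

Lemma sdmulA : associative sdmul.
Proof.
move=> [c b] [c' b'] [c'' b'']; rewrite /sdmul /= mulgA mactM.
by rewrite (mact_morphism a c).2 mulgA.
Qed.

Lemma sdmul1 : left_id sdone sdmul.
Proof. by move=> [c b]; rewrite /sdmul /= mact1 !mul1g. Qed.

Lemma sdmulr1 : right_id sdone sdmul.
Proof. by move=> [c b]; rewrite /sdmul /= (mact_morphism a c).1 !mulg1. Qed.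

HB.instance Definition _ :=
  isMonoid.Build (semidirect a) sdmulA sdmul1 sdmulr1.

End SemidirectMonoid.

Section SemidirectGroup.
Variables (C B : groupType) (a : monoid_action C B).

Definition sdinv (x : semidirect a) : semidirect a :=
  (x.1^-1, a x.1^-1 x.2^-1).

Lemma sdmulVg : left_inverse 1 sdinv ( *%g : semidirect a -> semidirect a -> semidirect a).
Proof.
move=> [c b]; rewrite /sdinv /mul /= /sdmul /= mulVg.
by rewrite -(mact_morphism a _).2 mulVg (mact_morphism a _).1.
Qed.

Lemma sdmulgV : right_inverse 1 sdinv ( *%g : semidirect a -> semidirect a -> semidirect a).
Proof.
move=> [c b]; rewrite /sdinv /mul /= /sdmul /= mulgV.
by rewrite -mactM mulgV mact1 mulgV.
Qed.

HB.instance Definition _ := hasInv.Build (semidirect a) sdinv.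
HB.instance Definition _ :=
  Monoid_isGroup.Build (semidirect a) sdmulVg sdmulgV.

End SemidirectGroup.

Section InfiniteCyclic.

(* Written multiplicatively: the integer [n] stands for [z ^ n]. *)
Definition Cinf : Type := int.

HB.instance Definition _ := Choice.copy Cinf int.

Definition cmul (m n : Cinf) : Cinf := (m + n)%R.
Definition cone : Cinf := 0%R.
Definition cinv (n : Cinf) : Cinf := (- n)%R.

Lemma cmulA : associative cmul. Proof. exact: GRing.addrA. Qed.
Lemma cmul1 : left_id cone cmul. Proof. exact: GRing.add0r. Qed.
Lemma cmulr1 : right_id cone cmul. Proof. exact: GRing.addr0. Qed.
Lemma cmulV : left_inverse cone cinv cmul. Proof. exact: GRing.addNr. Qed.
Lemma cmulrV : right_inverse cone cinv cmul. Proof. exact: GRing.addrN. Qed.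

HB.instance Definition _ := isMonoid.Build Cinf cmulA cmul1 cmulr1.
HB.instance Definition _ := hasInv.Build Cinf cinv.
HB.instance Definition _ := Monoid_isGroup.Build Cinf cmulV cmulrV.

Definition zC : Cinf := 1%R.

Definition Cpos : pred Cinf := [pred c | `[< exists n : nat, c = zC ^+ n >]].

Lemma Cpos_closed : umagma_closed Cpos.
Proof.
split=> [|x y /asboolP[m ->] /asboolP[n ->]]; apply/asboolP.
  by exists 0%N.
by exists (m + n)%N; rewrite expgnDr.
Qed.

Definition Cplus : Type := {c : Cinf | Cpos c}.

HB.instance Definition _ := SubChoice.on Cplus.
HB.instance Definition _ :=
  SubChoice_isSubMonoid.Build Cinf Cpos Cplus Cpos_closed.

Lemma zCplus_subproof : Cpos zC.
Proof. by apply/asboolP; exists 1%N. Qed.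

Definition zCplus : Cplus := exist _ zC zCplus_subproof.

End InfiniteCyclic.

Definition sidx (r : nat) := {j : nat | 3 <= j <= r}.

Inductive gen_inf (r : nat) : Type :=
| t_ of int
| s_ of sidx r.

Arguments t_ {r} i.

HB.instance Definition _ r := gen_eqMixin (gen_inf r).
HB.instance Definition _ r := gen_choiceMixin (gen_inf r).

Inductive rel_inf (r : nat) : seq (gen_inf r) -> seq (gen_inf r) -> Prop :=
| rel_far (i j : sidx r) of (val i + 2 <= val j) || (val j + 2 <= val i) :
    rel_inf [:: s_ i; s_ j] [:: s_ j; s_ i]
| rel_braid (i j : sidx r) of val j = (val i).+1 :
    rel_inf [:: s_ i; s_ j; s_ i] [:: s_ j; s_ i; s_ j]
| rel_tt (i j : int) :
    rel_inf [:: t_ i; t_ (i - 1)%R] [:: t_ j; t_ (j - 1)%R]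
| rel_s3t (k : sidx r) (i : int) of val k = 3 :
    rel_inf [:: s_ k; t_ i; s_ k] [:: t_ i; s_ k; t_ i]
| rel_st (j : sidx r) (i : int) of 4 <= val j :
    rel_inf [:: s_ j; t_ i] [:: t_ i; s_ j].

Definition Binfplus (r : nat) := pres_mon (@rel_inf r).
Definition Binf (r : nat) := pres_grp (@rel_inf r).

HB.instance Definition _ r := Monoid.on (Binfplus r).
HB.instance Definition _ r := Group.on (Binf r).

Inductive gen_de (r : nat) : Type :=
| z_
| inf_ of gen_inf r.

Arguments z_ {r}.

HB.instance Definition _ r := gen_eqMixin (gen_de r).
HB.instance Definition _ r := gen_choiceMixin (gen_de r).

Inductive rel_de (e r : nat) : seq (gen_de r) -> seq (gen_de r) -> Prop :=
| rel_of_inf u v of rel_inf u v :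
    rel_de e [seq inf_ x | x <- u] [seq inf_ x | x <- v]
| rel_zt (i : int) :
    rel_de e [:: z_; inf_ (t_ i)] [:: inf_ (t_ (i - e%:Z)%R); z_]
| rel_zs (j : sidx r) :
    rel_de e [:: z_; inf_ (s_ j)] [:: inf_ (s_ j); z_].

(* [B(de,e,r)] does not depend on [d], which does not occur in its presentation. *)
Definition Bdeplus (d e r : nat) := pres_mon (@rel_de e r).
Definition Bde (d e r : nat) := pres_grp (@rel_de e r).

HB.instance Definition _ d e r := Monoid.on (Bdeplus d e r).
HB.instance Definition _ d e r := Group.on (Bde d e r).

Definition Bdeplus_gen d e r (x : gen_de r) : Bdeplus d e r := pgen (@rel_de e r) x.
Definition Bde_gen d e r (x : gen_de r) : Bde d e r := pggen (@rel_de e r) x.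

Definition Bdeplus_to_Bde d e r : Bdeplus d e r -> Bde d e r :=
  mon_to_grp (R:=@rel_de e r).

Definition s_desc (r : nat) : seq (sidx r) :=
  pmap insub (rev (iota 3 (r - 2))).

Definition Lambda d e r : Bdeplus d e r :=
  ((\prod_(j <- s_desc r) Bdeplus_gen d e (inf_ (s_ j))) *
   (Bdeplus_gen d e (inf_ (t_ 1%R)) * Bdeplus_gen d e (inf_ (t_ 0%R)))) ^+ (r - 1).

Section Action.
Variables e r : nat.

(* Conjugation by [z ^ c], where conjugation by [z] sends [t_i] to [t_(i-e)]. *)
Definition shift (c : Cinf) (x : gen_inf r) : gen_inf r :=
  match x with
  | t_ i => t_ (i - c * e%:Z)%R
  | s_ j => s_ j
  end.

Lemma shift1 x : shift 1 x = x.
Proof. by case: x => //= i; rewrite [(1 : Cinf)]/(0%R : int) GRing.mul0r GRing.subr0. Qed.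

Lemma shiftM c c' x : shift (c * c') x = shift c (shift c' x).
Proof.
case: x => //= i; rewrite [(c * c')]/((c : int) + (c' : int))%R.
by rewrite GRing.mulrDl GRing.opprD GRing.addrA GRing.addrAC.
Qed.

Lemma shift_rel c u v : rel_inf u v -> rel_inf (map (shift c) u) (map (shift c) v).
Proof.
case=> /= [i j h|i j h|i j|k i h|j i h]; try by constructor.
by rewrite 2![(_ - 1 - _)%R]GRing.addrAC; exact: rel_tt.
Qed.

Definition act_Binfplus (c : Cinf) : Binfplus r -> Binfplus r :=
  plift (fun x => pgen (@rel_inf r) (shift c x)).

Definition act_Binf (c : Cinf) : Binf r -> Binf r :=
  pglift (fun x => pggen (@rel_inf r) (shift c x)).

Lemma shift_pgen c u v : rel_inf u v ->
  \prod_(x <- u) pgen (@rel_inf r) (shift c x) =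
  \prod_(x <- v) pgen (@rel_inf r) (shift c x).
Proof.
move=> /(shift_rel c) h; rewrite -!(big_map (shift c) xpredT) -!pword_prod.
by apply/pwordP; have := pcong_rel [::] [::] h; rewrite /= !cats0.
Qed.

Lemma shift_pggen c u v : rel_inf u v ->
  \prod_(x <- u) pggen (@rel_inf r) (shift c x) =
  \prod_(x <- v) pggen (@rel_inf r) (shift c x).
Proof.
move=> /(shift_rel c) h; rewrite -!(big_map (shift c) xpredT).
exact: pggen_rel.
Qed.

Lemma act_Binfplus_morphism c : monoid_morphism (act_Binfplus c).
Proof. exact: (plift_morphism (@shift_pgen c)). Qed.

Lemma act_BinfplusE c x :
  act_Binfplus c (pgen _ x) = pgen (@rel_inf r) (shift c x).
Proof. exact: (pliftE (@shift_pgen c)). Qed.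

Lemma act_Binf_morphism c : monoid_morphism (act_Binf c).
Proof. exact: (pglift_morphism (@shift_pggen c)). Qed.

Lemma act_BinfE c x :
  act_Binf c (pggen _ x) = pggen (@rel_inf r) (shift c x).
Proof. exact: (pgliftE (@shift_pggen c)). Qed.

Lemma comp_monoid_morphism (M N P : monoidType) (f : N -> P) (g : M -> N) :
  monoid_morphism f -> monoid_morphism g -> monoid_morphism (fun x => f (g x)).
Proof.
by move=> [f1 fM] [g1 gM]; split=> [|x y]; rewrite ?g1 ?f1 ?gM ?fM.
Qed.

Lemma act_Binfplus1 b : act_Binfplus 1 b = b.
Proof.
apply: (pres_mon_ext (g := idfun)) => //; first exact: act_Binfplus_morphism.
by move=> x; rewrite act_BinfplusE shift1.
Qed.

Lemma act_BinfplusM c c' b :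
  act_Binfplus (c * c') b = act_Binfplus c (act_Binfplus c' b).
Proof.
apply: (pres_mon_ext (g := fun b => act_Binfplus c (act_Binfplus c' b))).
- exact: act_Binfplus_morphism.
- by apply: comp_monoid_morphism; exact: act_Binfplus_morphism.
- by move=> x; rewrite !act_BinfplusE shiftM.
Qed.

Lemma act_Binf1 b : act_Binf 1 b = b.
Proof.
apply: (pres_grp_ext (g := idfun)) => //; first exact: act_Binf_morphism.
by move=> x; rewrite act_BinfE shift1.
Qed.

Lemma act_BinfM c c' b : act_Binf (c * c') b = act_Binf c (act_Binf c' b).
Proof.
apply: (pres_grp_ext (g := fun b => act_Binf c (act_Binf c' b))).
- exact: act_Binf_morphism.
- by apply: comp_monoid_morphism; exact: act_Binf_morphism.
- by move=> x; rewrite !act_BinfE shiftM.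
Qed.

Definition Binf_action : monoid_action Cinf (Binf r) :=
  MonoidAction act_Binf1 act_BinfM act_Binf_morphism.

Definition Binfplus_action : monoid_action Cplus (Binfplus r) :=
  @MonoidAction Cplus (Binfplus r) (fun c => act_Binfplus (val c))
    act_Binfplus1 (fun c c' => act_BinfplusM (val c) (val c'))
    (fun c => act_Binfplus_morphism (val c)).

End Action.

Definition gen_semidirect e r (x : gen_de r) : semidirect (Binf_action e r) :=
  match x with
  | z_ => sdpair (Binf_action e r) zC 1
  | inf_ y => sdpair (Binf_action e r) 1 (pggen (@rel_inf r) y)
  end.

Definition gen_semidirect_plus e r (x : gen_de r) :
    semidirect (Binfplus_action e r) :=
  match x with
  | z_ => sdpair (Binfplus_action e r) zCplus 1
  | inf_ y => sdpair (Binfplus_action e r) 1 (pgen (@rel_inf r) y)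
  end.

(* Main.v *)
Require Import Defs.
From mathcomp Require Import all_boot.
From mathcomp Require Import ssralg ssrint boolp zify.

(** In the presentation of [B^+(de,e,r)] any two distinct generators [x], [y] occur
    in exactly one relation [x (x \ y) = y (y \ x)], and all relations are
    homogeneous.  As in Garside's and Dehornoy's work, left cancellation and the
    fact that the common right multiples of [x] and [y] are the multiples of
    [x (x \ y)] follow by induction on the length, provided a "cube condition"
    holds for each triple of generators.  Up to generators that commute, possibly
    up to a shift (such as [z]), with the two others, the triples to examine are
    the paths of type [A_3] and the triples formed by [s_3] and two [t_i].  The
    statements on the right follow by applying the anti-involution that fixes [z]
    and [s_j] and sends [t_i] to [t_(-i)].

    With [y_k = s_k ... s_3 t_1 t_0 s_3 ... s_k] one has [Lambda = y_r ... y_3 y_2];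
    hence [Lambda] commutes with [s_j], and [Lambda t_i = t_(i+r) Lambda], so that
    [D = z Lambda] normalises the set of generators, each of which divides it.
    Such a [D] is a Garside element and yields common multiples, thus lcms and gcds.
    Injectivity of [B^+ -> B] is obtained by letting group words act on the
    fractions [m D^-k]. *)

Set Implicit Arguments.
Unset Strict Implicit.
Unset Printing Implicit Defensive.

Local Open Scope group_scope.

(** * Homogeneous presentations with a complement *)

Lemma pword_rel (X : choiceType) (R : seq X -> seq X -> Prop) u v :
  R u v -> pword R u = pword R v.
Proof. by move=> h; apply/pwordP; have := pcong_rel [::] [::] h; rewrite /= !cats0. Qed.

Lemma pword_cons (X : choiceType) (R : seq X -> seq X -> Prop) x u :
  pword R (x :: u) = pgen R x * pword R u.
Proof. exact: (pword_cat R [:: x] u). Qed.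

Lemma pword_nil (X : choiceType) (R : seq X -> seq X -> Prop) :
  pword R [::] = 1.
Proof. by []. Qed.

Lemma pres_mon_ind (X : choiceType) (R : seq X -> seq X -> Prop)
    (P : pres_mon R -> Prop) :
  P 1 -> (forall x m, P m -> P (pgen R x * m)) -> forall m, P m.
Proof.
move=> P1 PM m; rewrite -(pword_repr m).
by elim: (repr m) => [|x u IHu]; [exact: P1 | rewrite pword_cons; exact: PM].
Qed.

Section Homogeneous.
Variables (X : choiceType) (R : seq X -> seq X -> Prop).
Hypothesis R_size : forall u v, R u v -> size u = size v.

Local Notation M := (pres_mon R).
Local Notation g := (pgen R).
Local Notation W := (pword R).

Definition plen (m : M) : nat := size (repr m).

Lemma pcong_size u v : pcong R u v -> size u = size v.
Proof.
by elim=> [a u0 v0 b /R_size e|//|//|u0 v0 w _ -> _ ->//]; rewrite !size_cat e.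
Qed.

Lemma plen_word u : plen (W u) = size u.
Proof. by apply: pcong_size; apply/pwordP; rewrite pword_repr. Qed.

Lemma plen1 : plen 1 = 0%N. Proof. exact: plen_word. Qed.

Lemma plen_gen x : plen (g x) = 1%N. Proof. exact: plen_word. Qed.

Lemma plenM a b : plen (a * b) = (plen a + plen b)%N.
Proof.
by rewrite -{1}(pword_repr a) -{1}(pword_repr b) -pword_cat plen_word size_cat.
Qed.

Lemma plen_cons x a : plen (g x * a) = (plen a).+1.
Proof. by rewrite plenM plen_gen. Qed.

Lemma plen_eq0 m : plen m = 0%N -> m = 1.
Proof. by move=> /size0nil e; rewrite -(pword_repr m) e. Qed.

Lemma ldivides_plen (a b : M) : ldivides a b -> plen a <= plen b.
Proof. by case=> c ->; rewrite plenM leq_addr. Qed.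

Lemma pres_atomic : atomic M.
Proof.
move=> m; exists (plen m) => s + <-; elim: s => [//|x s IHs] ne1 /=.
have lex : 0 < plen x.
  by rewrite lt0n; apply/eqP => /plen_eq0; apply: ne1; rewrite mem_head.
rewrite big_cons plenM.
apply: (leq_add lex (IHs _)) => y ys.
by apply: ne1; rewrite inE ys orbT.
Qed.

Lemma ldivides_partial_order :
  partial_order (@ldivides M).
Proof.
split=> [x|x y z [c ->] [c' ->]|x y [c e] [c' e']].
- by exists 1; rewrite mulg1.
- by exists (c * c'); rewrite mulgA.
- have c1 : c = 1.
    apply: plen_eq0; have := congr1 plen e; rewrite {1}e' !plenM.  lia.
  by rewrite e c1 mulg1.
Qed.

End Homogeneous.

(** * From the cube condition to left cancellation and lcms *)

Section Complement.
Variables (X : choiceType) (R : seq X -> seq X -> Prop) (C : X -> X -> seq X).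

Local Notation M := (pres_mon R).
Local Notation g := (pgen R).
Local Notation W := (pword R).

Hypothesis R_size : forall u v, R u v -> size u = size v.
Hypothesis R_compl : forall u v, R u v ->
  u = v \/ exists x y, u = x :: C x y /\ v = y :: C y x.
Hypothesis Cxx : forall x, C x x = [::].

(** The bound on [plen A] allows common multiples of length at most [n]. As [C x x] is empty, the
    case [x = y] is left cancellation of a letter. *)
Definition lcm_below n := forall x y (A B : M), g x * A = g y * B ->
  plen A < n -> exists c, A = W (C x y) * c /\ B = W (C y x) * c.

(** This is what transitivity needs: [w] is the first letter of an intermediate word, whose tail has
    been resolved against [x] (giving [A]) and against [y] (giving [B]). The conclusion resolves [x]
    against [y] directly. *)
Definition cube n w x y := forall A B : M,
  W (C w x) * A = W (C w y) * B -> plen (W (C w x) * A) <= n ->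
  exists c, W (C x w) * A = W (C x y) * c /\ W (C y w) * B = W (C y x) * c.

Lemma cube_sym n w x y : cube n w x y -> cube n w y x.
Proof.
move=> h A B e le; case: (h B A (esym e)) => [|c [? ?]]; first by rewrite -e.
by exists c.
Qed.

Lemma lcm_below_cancel n x (A B : M) : lcm_below n ->
  g x * A = g x * B -> plen A < n -> A = B.
Proof. by move=> h e /(h _ _ _ _ e) [c []]; rewrite Cxx mul1g => -> ->. Qed.

Lemma lcm_below_cancelW n u (A B : M) : lcm_below n ->
  W u * A = W u * B -> plen (W u * A) <= n -> A = B.
Proof.
move=> h; elim: u => [|x u IHu]; first by rewrite !mul1g.
rewrite !pword_cons -!mulgA => e; rewrite !(plenM, plen_gen) // => le.
apply: IHu; last by rewrite plenM //; lia.
by apply: (lcm_below_cancel h e); rewrite plenM //; lia.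
Qed.

Lemma cube_eq n x y w : lcm_below n -> (x = y \/ w = x \/ w = y) -> cube n w x y.
Proof.
move=> h; case=> [<-|[|]].
- move=> A B e le; exists (W (C x w) * A); rewrite Cxx !mul1g.
  by rewrite (lcm_below_cancelW h e le).
- move=> <- A B; rewrite Cxx !mul1g => -> _; exists B; by [].
- move=> <- A B; rewrite Cxx !mul1g => <- _; exists A; by [].
Qed.

Hypothesis cubeP : forall n, lcm_below n -> forall w x y,
  x != y -> w != x -> w != y -> cube n w x y.

(** Induction on the derivation of the congruence between [x :: a] and [y :: b]. The tail of an
    intermediate word has length at most [n], so the cube condition at level [n] handles
    transitivity. *)
Lemma lcm_belowS n : lcm_below n -> lcm_below n.+1.
Proof.
move=> h.
have cubeA w x y : cube n w x y.
  case: (eqVneq x y) => [?|nxy]; first by apply: cube_eq => //; left.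
  case: (eqVneq w x) => [?|nwx]; first by apply: cube_eq => //; right; left.
  case: (eqVneq w y) => [?|nwy]; first by apply: cube_eq => //; right; right.
  exact: cubeP.
have main u v : pcong R u v -> size u <= n.+1 ->
    forall x y a b, u = x :: a -> v = y :: b ->
    exists c, W a = W (C x y) * c /\ W b = W (C y x) * c.
  elim=> {u v} [[|a0 a] u v b Ruv|u|u v uv IH|u v w uv IHu vw IHv] /= su x y a' b' eu ev.
  (* A relation at the front is trivial or a complement relation; one applied further on, in the
     next case, keeps the first letter. *)
  - case: (R_compl Ruv) => [euv|[x0 [y0 [eu0 ev0]]]].
      move: eu ev; rewrite euv => -> [<- <-]; exists (W a').
      by rewrite Cxx mul1g.
    move: eu ev; rewrite eu0 ev0 /= => -[<- <-] [<- <-].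
    by exists (W b); rewrite -!pword_cat.
  - case: eu ev => <- <- [<- <-].
    exists (W (a ++ u ++ b)); rewrite Cxx !mul1g; split=> //.
    by apply/pwordP; apply: pcong_sym; apply: pcong_rel.
  - move: ev; rewrite eu => -[<- <-]; exists (W a'); by rewrite Cxx mul1g.
  - have [|c [? ?]] := IH _ y x b' a' ev eu; last by exists c.
    by rewrite (pcong_size R_size uv).
  - have sv : size v = size u by rewrite (pcong_size R_size uv).
    (* The intermediate word is nonempty by its length; its first letter [z] is the apex of the
       cube. *)
    case: v sv uv vw IHu IHv => [|z z'] sv uv vw IHu IHv; first by move: sv; rewrite eu.
    have [c1 [e1 e1']] := IHu su x z a' z' eu erefl.
    have [|c2 [e2 e2']] := IHv _ z y z' b' erefl ev; first by rewrite sv.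
    have [||c [? ?]] := @cubeA z x y c1 c2; first by rewrite -e1' -e2.
      by rewrite -e1' plen_word //; rewrite /= in sv; lia.
    by exists c; rewrite e1 e2'.
move=> x y A B e le.
have := main (x :: repr A) (y :: repr B); rewrite -!pwordP !pword_cons !pword_repr.
by move=> /(_ e le _ _ _ _ erefl erefl); rewrite !pword_repr.
Qed.

Lemma lcm_belowP n : lcm_below n.
Proof. by elim: n => [//|n /lcm_belowS]. Qed.

Lemma pres_lcancel : right_injective ( *%g : M -> M -> M).
Proof.
move=> m A B e; apply: (lcm_below_cancelW (u := repr m) (@lcm_belowP (plen (m * A)))).
  by rewrite pword_repr.
by rewrite pword_repr.
Qed.

Hypothesis C_lcm : forall x y, W (x :: C x y) = W (y :: C y x).

(** Induction on the length of the common multiple [m]. For [x a] and [y b], with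
    [g x * p = g y * q] the lcm of the letters, let [p * p1] be the lcm of [a] and [p], and [q * q1]
    that of [b] and [q]. If [L] is the lcm of [p1] and [q1], the join is [g x * p * L]. The smaller
    joins exist because quotients of [m] are common multiples. *)
Lemma cond_join (a b m : M) : ldivides a m -> ldivides b m ->
  exists j, is_join (@ldivides M) a b j.
Proof.
have lc := pres_lcancel.
have join1 (b' : M) : is_join (@ldivides M) 1 b' b'.
  by split=> [||//]; [exists b'; rewrite mul1g|exists 1; rewrite mulg1].
have join1' (b' : M) : is_join (@ldivides M) b' 1 b'.
  by split=> [||//]; [exists 1; rewrite mulg1|exists b'; rewrite mul1g].
have [n le] := ubnP (plen m); elim: n a b m le => [//|n IHn] a b m le.
elim/pres_mon_ind: a => [|x a _]; first by exists b.
elim/pres_mon_ind: b => [|y b _]; first by exists (g x * a).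
case=> a1 ea [b1 eb].
have e := etrans (esym ea) eb; rewrite -!mulgA in e.
have [n' [en1 en2]] := @lcm_belowP (plen (a * a1)).+1 _ _ _ _ e (leqnn _).
set p := W (C x y) in en1; set q := W (C y x) in en2.
have pq : g x * p = g y * q by rewrite /p /q -!pword_cons C_lcm.
have lem : plen m = (plen (a * a1)).+1.
  by rewrite ea -mulgA plen_cons.
have lem' : plen m = (plen (b * b1)).+1.
  by rewrite eb -mulgA plen_cons.
have [|||l1 [a_l1 [p1 ep1] l1P]] := IHn a p (a * a1); first by lia.
- by exists a1.
- by exists n'.
have [|||l2 [b_l2 [q1 eq1] l2P]] := IHn b q (b * b1); first by lia.
- by exists b1.
- by exists n'.
have div1 w : ldivides a (p * w) -> ldivides p1 w.
  move=> h; have [|c] := l1P _ h; first by exists w.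
  by rewrite ep1 -mulgA => /lc ->; exists c.
have div2 w : ldivides b (q * w) -> ldivides q1 w.
  move=> h; have [|c] := l2P _ h; first by exists w.
  by rewrite eq1 -mulgA => /lc ->; exists c.
have [|||L [p_L q_L LP]] := IHn p1 q1 n'.
- by move: lem; rewrite en1 plenM //; lia.
- by apply: div1; rewrite -en1; exists a1.
- by apply: div2; rewrite -en2; exists b1.
exists (g x * p * L); split.
- case: p_L a_l1 => c -> [c' e1]; exists (c' * c).
  by rewrite -!mulgA (mulgA p) -ep1 e1 !mulgA.
- case: q_L b_l2 => c -> [c' e1]; exists (c' * c).
  by rewrite pq -!mulgA (mulgA q) -eq1 e1 !mulgA.
- move=> w [w1 ew1] [w2 ew2].
  have ew := etrans (esym ew1) ew2; rewrite -!mulgA in ew.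
  have [w' [ew' ew'']] := @lcm_belowP (plen (a * w1)).+1 _ _ _ _ ew (leqnn _).
  have [||c ewc] := LP w'.
  - by apply: div1; rewrite -/p in ew'; rewrite -ew'; exists w1.
  - by apply: div2; rewrite -/q in ew''; rewrite -ew''; exists w2.
  by exists c; rewrite ew1 -[LHS]mulgA ew' ewc !mulgA.
Qed.

Hypothesis common_mul : forall a b : M, exists2 m, ldivides a m & ldivides b m.

Lemma ldivides_lattice : lattice_order (@ldivides M).
Proof.
split; first exact: (ldivides_partial_order R_size).
(* The meet is a common divisor of maximal length: its join with any other common divisor still
   divides [x] and [y], so it cannot be longer. *)
- move=> x y.
  pose P k := `[< exists2 d : M, ldivides d x /\ ldivides d y & plen d = k >].
  have exP : exists k, P k.
    exists 0%N; apply/asboolP; exists 1; last exact: plen1.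
    by split; [exists x | exists y]; rewrite mul1g.
  have ubP k : P k -> k <= plen x.
    by case/asboolP => d [dx _] <-; exact: (ldivides_plen R_size).
  case: (ex_maxnP exP ubP) => k /asboolP [d [dx dy] dk] kmax.
  exists d; split=> // w wx wy.
  have [j [[c ej] wj jP]] := cond_join dx wx.
  have jk : plen j <= k.
    by apply: kmax; apply/asboolP; exists j => //; split; exact: jP.
  have c1 : c = 1 by apply: plen_eq0; move: jk; rewrite ej plenM //; lia.
  by move: wj; rewrite ej c1 mulg1.
- by move=> x y; have [m xm ym] := common_mul x y; exact: cond_join xm ym.
Qed.

End Complement.

(** * Quasi-central elements and fractions *)

Section AntiInvolution.
Variables (M : monoidType) (rho : M -> M).
Hypothesis rhoM : forall a b, rho (a * b) = rho b * rho a.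
Hypothesis rhoK : involutive rho.

Lemma anti_cancellative :
  right_injective ( *%g : M -> M -> M) -> cancellative M.
Proof.
move=> lc; split=> // m a b e; apply: (inv_inj rhoK); apply: (lc (rho m)).
by rewrite -!rhoM; congr rho.
Qed.

Lemma anti_divides a b : rdivides a b <-> ldivides (rho a) (rho b).
Proof.
split=> [[c ->]|[c e]]; first by exists (rho c); rewrite rhoM.
by exists (rho c); rewrite -[b]rhoK e rhoM rhoK.
Qed.

Lemma anti_lattice :
  lattice_order (@ldivides M) -> lattice_order (@rdivides M).
Proof.
case=> -[lxx ltr las] lmeet ljoin; split.
- split=> [x|x y z|x y]; rewrite !anti_divides //; first exact: ltr.
  by move=> xy yx; apply: (inv_inj rhoK); exact: las.
- move=> x y; have [m [mx my mP]] := lmeet (rho x) (rho y); exists (rho m).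
  by split=> [||w]; rewrite !anti_divides ?rhoK //; exact: mP.
- move=> x y; have [m [mx my mP]] := ljoin (rho x) (rho y); exists (rho m).
  by split=> [||w]; rewrite !anti_divides ?rhoK //; exact: mP.
Qed.

End AntiInvolution.

Section QuasiCentral.
Variables (M : monoidType) (D : M).
Hypothesis lcancel : right_injective ( *%g : M -> M -> M).
Hypothesis rcancel : left_injective ( *%g : M -> M -> M).
Hypothesis D_left : forall m, exists m', D * m = m' * D.
Hypothesis D_right : forall m, exists m', m * D = D * m'.
Hypothesis D_gen : forall m, exists2 s : seq M,
  forall x, x \in s -> ldivides x D & m = \prod_(x <- s) x.

(** If [D = a * b], then [D * b = b' * D = b' * a * b], and cancelling [b] gives [D = b' * a]; the
    other direction is symmetric. *)
Lemma quasi_central_garside : garside_element D.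
Proof.
split=> // a; split=> -[b e].
  have [b' eb] := D_left b; exists b'; apply: (rcancel (x := b)).
  by rewrite [LHS]eb {1}e mulgA.
have [b' eb] := D_right b; exists b'; apply: (lcancel (y := b)).
by rewrite [LHS]eb {1}e mulgA.
Qed.

Lemma quasi_central_expr k m : exists m', m * D ^+ k = D ^+ k * m'.
Proof.
elim: k m => [|k IHk] m; first by exists m; rewrite expg0 mul1g mulg1.
have [m1 e1] := D_right m; have [m2 e2] := IHk m1.
by exists m2; rewrite expgS mulgA e1 -mulgA e2 mulgA.
Qed.

Lemma quasi_central_expl k m : exists m', D ^+ k * m = m' * D ^+ k.
Proof.
elim: k m => [|k IHk] m; first by exists m; rewrite expg0 mul1g mulg1.
have [m1 e1] := D_left m; have [m2 e2] := IHk m1.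
by exists m2; rewrite expgSr -mulgA e1 mulgA e2 mulgA.
Qed.

(** Induction on the number of divisors of [D] in a factorisation of [m]: the cofactor of the first
    one is moved past the power of [D] obtained for the others. *)
Lemma ldivides_expr m : exists k, ldivides m (D ^+ k).
Proof.
have [s + ->] := D_gen m; elim: s => [|x s IHs] sD.
  by exists 0%N; exists 1; rewrite big_nil mulg1.
have [y ys|k [c ek]] := IHs; first by apply: sD; rewrite inE ys orbT.
have [c' ec'] := sD x (mem_head _ _).
have [d ed] := quasi_central_expr k c'.
exists k.+1; exists (c * d); rewrite big_cons expgS {1}ec' -[LHS]mulgA ed ek.
by rewrite !mulgA.
Qed.

Lemma common_multiple (a b : M) : exists2 m, ldivides a m & ldivides b m.
Proof.
have [k [c ec]] := ldivides_expr a; have [l [c' ec']] := ldivides_expr b.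
exists (D ^+ (k + l)).
  by exists (c * D ^+ l); rewrite expgnDr ec mulgA.
by exists (c' * D ^+ k); rewrite addnC expgnDr ec' mulgA.
Qed.

End QuasiCentral.

(** * Embedding in the group of fractions *)

Section Fractions.
Variables (X : choiceType) (R : seq X -> seq X -> Prop).
Local Notation M := (pres_mon R).
Local Notation g := (pgen R).
Local Notation f := (mon_to_grp (R := R)).
Variables (D : M) (tau : M -> M) (comp : X -> M).
Hypothesis lcancel : right_injective ( *%g : M -> M -> M).
Hypothesis rcancel : left_injective ( *%g : M -> M -> M).
Hypothesis tauP : forall m, m * D = D * tau m.
Hypothesis D_left : forall m, exists m', D * m = m' * D.
Hypothesis compP : forall x, D = comp x * g x.

Lemma tauM a b : tau (a * b) = tau a * tau b.
Proof.
by apply: (lcancel (y := D)); rewrite -tauP -mulgA tauP mulgA tauP !mulgA.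
Qed.

Lemma tauD : tau D = D.
Proof. by apply: (lcancel (y := D)); rewrite -tauP. Qed.

Lemma tauDX k : tau (D ^+ k) = D ^+ k.
Proof. by apply: (lcancel (y := D)); rewrite -tauP -expgSr -expgS. Qed.

(** Cancel [comp x] in [comp x * g x * tau (comp x) = D * tau (comp x) = comp x * D]. This makes the
    formal inverse of a letter act as an inverse on the other side too. *)
Lemma comp_tau x : g x * tau (comp x) = D.
Proof.
by apply: (lcancel (y := comp x)); rewrite mulgA -compP -tauP.
Qed.

(* The pair [(m, k)] stands for the fraction [m D^-k]; as [x^-1 = D^-1 (comp x)],
   group words act on fractions by left multiplication. *)
Definition letter_act (l : X * bool) (p : M * nat) : M * nat :=
  if l.2 then (g l.1 * p.1, p.2) else (tau (comp l.1 * p.1), p.2.+1).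

Definition word_act w p := foldr letter_act p w.

(** Cross-multiplication, which models equality of [m D^-k] and [m' D^-k'] because powers of [D]
    commute with each other. *)
Definition frac_eq (p q : M * nat) := p.1 * D ^+ q.2 = q.1 * D ^+ p.2.

Lemma frac_eq_trans p q r : frac_eq p q -> frac_eq q r -> frac_eq p r.
Proof.
rewrite /frac_eq => pq qr; apply: (rcancel (x := D ^+ q.2)).
rewrite -[LHS]mulgA -expgnDr addnC expgnDr mulgA pq.
rewrite -[LHS]mulgA -expgnDr addnC expgnDr mulgA qr.
by rewrite -[LHS]mulgA -[RHS]mulgA -!expgnDr addnC.
Qed.

Lemma letter_act_eq l p q :
  frac_eq p q -> frac_eq (letter_act l p) (letter_act l q).
Proof.
rewrite /frac_eq /letter_act; case: l => x [] /= e; first by rewrite -!mulgA e.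
rewrite -(tauDX q.2.+1) -(tauDX p.2.+1) -!tauM !expgSr !mulgA -(mulgA _ p.1) e.
by rewrite !mulgA.
Qed.

Lemma word_act_eq w p q :
  frac_eq p q -> frac_eq (word_act w p) (word_act w q).
Proof. by move=> e; elim: w => [//|l w IHw]; exact: letter_act_eq. Qed.

Lemma word_act_pos u p :
  word_act [seq (x, true) | x <- u] p = (pword R u * p.1, p.2).
Proof.
elim: u => [|x u IHu]; first by case: p => m k; rewrite /= mul1g.
by rewrite pword_cons -mulgA /= IHu.
Qed.

Lemma word_act_pcong u v p :
  pcong (grp_rel R) u v -> frac_eq (word_act u p) (word_act v p).
Proof.
move=> uv; elim: uv p => [a u0 v0 b uv0|//|u0 v0 _ IH|u0 v0 w _ IH1 _ IH2] p.
- rewrite /word_act !foldr_cat; apply: word_act_eq.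
  case: uv0 => [u1 v1 /pword_rel e|x c].
    by rewrite -!/(word_act _ _) !word_act_pos e.
  move: (foldr letter_act p b) => [m k]; rewrite /frac_eq /letter_act.
  (* In either order a letter and its inverse turn [(m, k)] into [(m * D, k.+1)], as
     [D * tau m = m * D]. *)
  case: c; rewrite /= tauM expgS.
    by rewrite !mulgA comp_tau tauP.
  rewrite -tauM mulgA -compP tauM tauD !mulgA.
  by rewrite -tauP.
- exact: esym (IH p).
- exact: frac_eq_trans (IH1 p) (IH2 p).
Qed.

Lemma mon_to_grp_word u : f (pword R u) = pgword R [seq (x, true) | x <- u].
Proof.
rewrite /mon_to_grp (plift_word (@pggen_rel _ R)) [RHS]pword_prod.
by rewrite big_map.
Qed.

(** Two positive words equal in the group act alike on the fraction [(1, 0)], where they produce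
    their own classes in [M]. *)
Lemma mon_to_grp_inj : injective f.
Proof.
move=> a b; rewrite -(pword_repr a) -(pword_repr b) !mon_to_grp_word.
move/pwordP/(word_act_pcong (1, 0%N)); rewrite !word_act_pos /frac_eq /=.
by rewrite !mulg1.
Qed.

(** Letters are absorbed from the left. An inverse letter is [D^-1 (comp x)], and
    [D^-1 y = tau y D^-1] carries the denominator to the right. *)
Lemma right_fraction (x : pres_grp R) : exists a k, x = f a / f (D ^+ k).
Proof.
have [f1 fM] := mon_to_grp_morphism R.
elim/pres_mon_ind: x => [|[x b] m [a [k ->]]].
  by exists 1, 0%N; rewrite expg0 f1 divgg.
case: b.
  by exists (g x * a), k; rewrite fM mon_to_grpE mulgA.
exists (tau (comp x * a)), k.+1.
have -> : pgen (grp_rel R) (x, false) = (f D)^-1 * f (comp x).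
  rewrite -[LHS]/(pgword R [:: (x, false)]) -pggenV -mon_to_grpE (compP x) fM.
  by rewrite invgM -mulgA mulVg mulg1.
have ft y : (f D)^-1 * f y = f (tau y) / f D.
  by apply: (mulIg (f D)); rewrite -!mulgA mulVg mulg1 -fM tauP fM mulKg.
rewrite mulgA -[(f D)^-1 * f _ * f a]mulgA -fM ft.
by rewrite expgSr fM invgM mulgA.
Qed.

Lemma fractions : group_of_fractions f.
Proof.
have [f1 fM] := mon_to_grp_morphism R.
split; [exact: mon_to_grp_morphism|exact: mon_to_grp_inj| |] => x;
  have [a [k ->]] := right_fraction x.
  by exists a, (D ^+ k).
(* A right fraction becomes a left one by [D ^+ k * a = b * D ^+ k]. *)
have [b eb] := quasi_central_expl D_left k a.
exists (D ^+ k), b; apply: (mulgI (f (D ^+ k))).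
by rewrite mulgA -fM eb fM mulgK mulVKg.
Qed.

End Fractions.

(** * The cube condition *)

Section Cubes.
Variables (X : choiceType) (R : seq X -> seq X -> Prop) (C : X -> X -> seq X).
Local Notation M := (pres_mon R).
Local Notation g := (pgen R).
Local Notation W := (pword R).

Hypothesis R_size : forall u v, R u v -> size u = size v.
Hypothesis C_lcm : forall x y, W (x :: C x y) = W (y :: C y x).
Hypothesis Cxx : forall x, C x x = [::].
Variable n : nat.
Hypothesis lcmn : lcm_below R C n.

Lemma lcm_step x y (A B : M) : g x * A = g y * B -> plen (g x * A) <= n ->
  exists c, A = W (C x y) * c /\ B = W (C y x) * c.
Proof. by move=> e; rewrite plen_cons // => /(lcmn e). Qed.

Section Skew.
Variables (v : X) (s : X -> X).

Lemma skew_word u : (forall l, l \in u -> C v l = [:: s l] /\ C l v = [:: v]) ->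
  g v * W (map s u) = W u * g v.
Proof.
elim: u => [|l u IHu] h; first by rewrite mul1g mulg1.
have [cvl clv] := h l (mem_head _ _); have e := C_lcm v l.
rewrite cvl clv !pword_cons !pword_nil !mulg1 in e.
rewrite /= !pword_cons mulgA e -!mulgA IHu // => k ku.
by apply: h; rewrite inE ku orbT.
Qed.

Lemma skew_step u (A B : M) :
  (forall l, l \in u -> C v l = [:: s l] /\ C l v = [:: v]) ->
  g v * A = W u * B -> plen (g v * A) <= n ->
  exists c, A = W (map s u) * c /\ B = g v * c.
Proof.
elim: u A B => [|l u IHu] A B h.
  by rewrite mul1g => <- _; exists A; rewrite mul1g.
rewrite pword_cons -mulgA => e le; have [c []] := lcm_step e le.
have [-> ->] := h l (mem_head _ _); rewrite !pword_cons !pword_nil !mulg1 => eA eB.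
have [k ku||d [ec ->]] := IHu c B _ (esym eB).
- by apply: h; rewrite inE ku orbT.
- by move: le; rewrite eA !plen_cons //; lia.
by exists d; rewrite eA ec mulgA.
Qed.

End Skew.

(* [v] behaves towards [x] and [y] as a letter acting by conjugation through [s]. *)
Definition skew v s x y :=
  [/\ forall l, l \in x :: y :: C x y ++ C y x -> C v l = [:: s l] /\ C l v = [:: v],
      C (s x) (s y) = map s (C x y) & C (s y) (s x) = map s (C y x)].

(** The lcm square of [x] and [y] is carried by [s] to that of [s x] and [s y], and [v] slides
    across it. *)
Lemma cube_skew_mid v s x y : skew v s x y -> cube R C n v x y.
Proof.
case=> h exy eyx A B.
have [cvx cxv] : C v x = [:: s x] /\ C x v = [:: v] by apply: h; rewrite !inE eqxx.
have [cvy cyv] : C v y = [:: s y] /\ C y v = [:: v].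
  by apply: h; rewrite !inE eqxx orbT.
have hxy : g v * W (map s (C x y)) = W (C x y) * g v.
  by apply: skew_word => l lu; apply: h; rewrite !inE mem_cat lu !orbT.
have hyx : g v * W (map s (C y x)) = W (C y x) * g v.
  by apply: skew_word => l lu; apply: h; rewrite !inE mem_cat lu !orbT.
rewrite cvx cvy cxv cyv !pword_cons !pword_nil !mulg1 => e le.
have [c [-> ->]] := lcm_step e le; exists (g v * c).
by rewrite exy eyx !mulgA hxy hyx.
Qed.

(** Here [v] slides past the complement [C w y], and the two paths close up by the lcm relation of
    [s w] and [s y]. *)
Lemma cube_skew_end v s w y : skew v s w y -> cube R C n w v y.
Proof.
case=> h exy eyx A B.
have [cvx cxv] : C v w = [:: s w] /\ C w v = [:: v] by apply: h; rewrite !inE eqxx.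
have [cvy cyv] : C v y = [:: s y] /\ C y v = [:: v].
  by apply: h; rewrite !inE eqxx orbT.
have hyx : g v * W (map s (C y w)) = W (C y w) * g v.
  by apply: skew_word => l lu; apply: h; rewrite !inE mem_cat lu !orbT.
rewrite cvx cvy cxv cyv !pword_cons !pword_nil !mulg1 => e le.
have [|c [-> ->]] := skew_step (s := s) _ e le.
  by move=> l lu; apply: h; rewrite !inE mem_cat lu !orbT.
exists (W (map s (C y w)) * c).
by rewrite !mulgA -hyx -!pword_cons -exy -eyx C_lcm.
Qed.

Definition adj a b := C a b = [:: b; a] /\ C b a = [:: a; b].
Definition far a b := C a b = [:: b] /\ C b a = [:: a].

Lemma adjE a b : adj a b -> forall c,
  g a * (g b * (g a * c)) = g b * (g a * (g b * c)).
Proof.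
case=> e1 e2 c; have := C_lcm a b; rewrite e1 e2 !pword_cons !pword_nil !mulg1.
by move=> e; rewrite !(mulgA _ _ c) (mulgA (g a)) (mulgA (g b)) -!(mulgA _ _ (g _)) e !mulgA.
Qed.

Lemma farE a b : far a b -> forall c, g a * (g b * c) = g b * (g a * c).
Proof.
case=> e1 e2 c; have := C_lcm a b; rewrite e1 e2 !pword_cons !pword_nil !mulg1.
by rewrite !mulgA => ->.
Qed.

Lemma gen_cancel x (A B : M) : g x * A = g x * B -> plen (g x * A) <= n -> A = B.
Proof. by move=> e; rewrite plen_cons // => /(lcm_below_cancel Cxx lcmn e). Qed.

Ltac len := match goal with le : is_true (plen _ <= n) |- _ =>
  move: le; rewrite ?plen_cons //; lia end.

(** Repeated use of [lcm_step] forces [A] and [B] to be explicit words followed by a common factor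
    [G]; what remains is an identity between braid words of type [A_3]. *)
Lemma cube_path_mid a b c : adj a b -> adj b c -> far a c -> cube R C n b a c.
Proof.
move=> ab bc ac A B; have [Cab Cba] := ab; have [Cbc Ccb] := bc.
have [Cac Cca] := ac; rewrite !(Cab, Cba, Cbc, Ccb, Cac, Cca).
rewrite !pword_cons !pword_nil !mulg1 -!mulgA => e le.
have [D [eA eB]] := lcm_step e le.
move: eA eB; rewrite Cac Cca !pword_cons pword_nil !mulg1 => eA eB.
have [|E [eA' eD]] := lcm_step eA; first by len.
move: eA' eD; rewrite Cbc Ccb !pword_cons pword_nil !mulg1 -!mulgA => eA' eD; subst A D.
have [|F [eB' eD]] := lcm_step eB; first by rewrite eB; len.
move: eB' eD; rewrite Cab Cba !pword_cons pword_nil !mulg1 -!mulgA => eB' eD; subst B.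
have e1 := gen_cancel eD; have {}e1 : g c * E = g a * F by apply: e1; len.
have [|G [eE eF]] := lcm_step e1; first by len.
move: eE eF; rewrite Cac Cca !pword_cons pword_nil !mulg1 => eE eF; subst E F.
exists (g b * (g a * (g c * (g b * G)))); split.
  rewrite (farE ac (g b * (g a * G))) (adjE ab G) (adjE bc (g a * _)).
  by rewrite (farE ac (g b * G)).
rewrite -(farE ac (g b * (g c * G))) -(adjE bc G).
by rewrite (adjE ab (g c * _)).
Qed.

Lemma cube_path_end a b c : adj a b -> adj b c -> far a c -> cube R C n a b c.
Proof.
move=> ab bc ac A B; have [Cab Cba] := ab; have [Cbc Ccb] := bc.
have [Cac Cca] := ac; rewrite !(Cab, Cba, Cbc, Ccb, Cac, Cca).
rewrite !pword_cons !pword_nil !mulg1 -!mulgA => e le.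
have [D [eA eB]] := lcm_step e le.
move: eA eB; rewrite Cbc Ccb !pword_cons pword_nil !mulg1 -!mulgA => eA eB; subst B.
have [|E [eA' eD]] := lcm_step eA; first by len.
move: eA' eD; rewrite Cac Cca !pword_cons pword_nil !mulg1 => eA' eD; subst A.
have [|F [eD' eE]] := lcm_step eD; first by rewrite eD; len.
move: eD' eE; rewrite Cab Cba !pword_cons pword_nil !mulg1 -!mulgA => eD' eE; subst D E.
exists (g a * (g b * (g c * F))); rewrite -!mulgA; split.
  rewrite (adjE bc (g a * F)) (farE ac (g b * (g c * (g a * F)))).
  by rewrite -(farE ac F) (adjE ab (g c * F)).
rewrite -(farE ac (g b * F)) (adjE ab (g c * _)) (adjE bc F).
by rewrite (farE ac (g b * _)).
Qed.

(** * Letters [t i] with a common product [t i * t (p i)], joined to a letter [s] *)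

Section DihedralFamily.
Variables (I : eqType) (t : I -> X) (p : I -> I) (s : X).
Hypothesis p_neq : forall i, i != p i.
Hypothesis p_inj : injective p.
Hypothesis Ct : forall i j, i != j -> C (t i) (t j) = [:: t (p i)].
Hypothesis st : forall i, adj s (t i).

Lemma dihE i j c : g (t i) * (g (t (p i)) * c) = g (t j) * (g (t (p j)) * c).
Proof.
have [->//|nij] := eqVneq i j; have nji : j != i by rewrite eq_sym.
have := C_lcm (t i) (t j); rewrite !Ct // !pword_cons !pword_nil !mulg1 => e.
by rewrite mulgA e !mulgA.
Qed.

(** [C (t k) (t i)] depends only on [k], so both sides of the hypothesis start with [t (p k)] and
    [A = B]. *)
Lemma cube_dih i j k : i != j -> k != i -> k != j -> cube R C n (t k) (t i) (t j).
Proof.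
move=> nij nki nkj A B; have nji : j != i by rewrite eq_sym.
have nik : i != k by rewrite eq_sym.
have njk : j != k by rewrite eq_sym.
by rewrite !Ct // !pword_cons pword_nil !mulg1 => /gen_cancel e /e ->; exists B.
Qed.

Lemma cube_dih_mid i j : i != j -> cube R C n s (t i) (t j).
Proof.
move=> nij A B; have nji : j != i by rewrite eq_sym.
have C1 k : C s (t k) = [:: t k; s] by case: (st k).
have C2 k : C (t k) s = [:: s; t k] by case: (st k).
rewrite !(C1, C2) !Ct // !pword_cons !pword_nil !mulg1 -!mulgA => e le.
have [D [eA eB]] := lcm_step e le.
move: eA eB; rewrite !Ct // !pword_cons pword_nil !mulg1 => eA eB.
have [|E [eA' eD]] := lcm_step eA; first by len.
move: eA' eD; rewrite C1 C2 !pword_cons pword_nil !mulg1 -!mulgA => eA' eD.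
subst A D.
have [|F [eB' eD]] := lcm_step eB; first by rewrite eB; len.
move: eB' eD; rewrite C1 C2 !pword_cons pword_nil !mulg1 -!mulgA => eB' eD.
subst B; have e1 := gen_cancel eD.
have {}e1 : g (t (p i)) * E = g (t (p j)) * F by apply: e1; len.
have [|G [eE eF]] := lcm_step e1; first by len.
move: eE eF; rewrite !Ct ?(inj_eq p_inj) // !pword_cons pword_nil !mulg1.
move=> eE eF; subst E F.
(* The last factor on the right is the same for all [k], because [t k * t (p k)] is; the cases
   [k = i] and [k = j] give the two halves. *)
have key k : g s * (g (t k) * (g (t (p k)) * (g s * (g (t (p (p k))) * G)))) =
    g (t (p k)) * (g s * (g (t i) * (g (t (p i)) * (g s * G)))).
  rewrite (dihE k (p k)) -(adjE (st _) G) (adjE (st _) (g (t (p (p k))) * _)).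
  by rewrite (dihE (p k) i).
by exists (g s * (g (t i) * (g (t (p i)) * (g s * G)))).
Qed.

Lemma cube_dih_end j k : k != j -> cube R C n (t k) s (t j).
Proof.
move=> nkj A B; have njk : j != k by rewrite eq_sym.
have C1 i : C s (t i) = [:: t i; s] by case: (st i).
have C2 i : C (t i) s = [:: s; t i] by case: (st i).
rewrite !(C1, C2) !Ct // !pword_cons !pword_nil !mulg1 -!mulgA => e le.
have [D [eA eB]] := lcm_step e le.
move: eA eB; rewrite C1 C2 !pword_cons pword_nil !mulg1 -!mulgA => eA eB.
subst B.
have [|E [eA' eD]] := lcm_step eA; first by len.
move: eA' eD; rewrite !Ct ?p_neq // 1?eq_sym ?p_neq //.
rewrite !pword_cons pword_nil !mulg1 => eA' eD; subst A.
have [|F [eD' eE]] := lcm_step eD; first by rewrite eD; len.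
move: eD' eE; rewrite C1 C2 !pword_cons pword_nil !mulg1 -!mulgA => eD' eE.
subst D E; exists (g (t (p j)) * (g s * (g (t (p (p j))) * F))); rewrite -!mulgA; split.
  rewrite (adjE (st _) (g (t (p (p k))) * F)) (dihE k j) (dihE (p k) (p j)).
  by rewrite -(adjE (st _) (g (t (p (p j))) * F)).
rewrite (dihE (p k) (p j)) -(adjE (st _) (g (t (p (p j))) * _)).
by rewrite (adjE (st _) F) (dihE (p j) j).
Qed.

End DihedralFamily.
End Cubes.

(** * The complement of the presentation of B(de,e,r) *)

Section Compl.
Variables e r : nat.

(* All the [t_i] sit at the node [2] of the diagram, next to [s_3]. *)
Definition node (a : gen_inf r) : nat := if a is s_ j then val j else 2.

Definition adjn (m k : nat) := (m == k.+1) || (k == m.+1).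

(** As [t_i t_(i-1)] is the same for all [i], the lcm of two distinct [t_i], [t_j] is this product.
    All other pairs are read off the diagram, which is a path. *)
Definition compl_inf (a b : gen_inf r) : seq (gen_inf r) :=
  match a, b with
  | t_ i, t_ j => if i == j then [::] else [:: t_ (i - 1)%R]
  | _, _ => if node a == node b then [::]
            else if adjn (node a) (node b) then [:: b; a] else [:: b]
  end.

(** The shift by [-1] comes from reading [z t_(i+e) = t_i z] as a relation with first letters [z]
    and [t_i]. *)
Definition compl (x y : gen_de r) : seq (gen_de r) :=
  match x, y with
  | z_, z_ => [::]
  | z_, inf_ b => [:: inf_ (shift e (-1)%R b)]
  | inf_ a, z_ => [:: z_]
  | inf_ a, inf_ b => map (@inf_ r) (compl_inf a b)
  end.

Lemma node_s (j : sidx r) : 2 < node (s_ j).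
Proof. by case: j => j /= /andP[]. Qed.

Lemma adjn_sym m k : adjn m k = adjn k m.
Proof. by rewrite /adjn orbC. Qed.

Lemma adjn_neq m k : adjn m k -> m != k.
Proof. by rewrite /adjn; lia. Qed.

Lemma node_eq a b : node a = node b -> a = b \/ exists i j, a = t_ i /\ b = t_ j.
Proof.
case: a b => [i|i] [j|j] /= h; [by right; exists i, j| | |].
- by have := node_s j; rewrite /= -h.
- by have := node_s i; rewrite /= h.
- by left; congr s_; apply: val_inj.
Qed.

Lemma compl_inf_adj a b : adjn (node a) (node b) -> compl_inf a b = [:: b; a].
Proof.
by case: a b => [i|i] [j|j] //= h; rewrite h (negPf (adjn_neq h)).
Qed.

Lemma compl_inf_far a b : node a != node b -> ~~ adjn (node a) (node b) ->
  compl_inf a b = [:: b].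
Proof. by case: a b => [i|i] [j|j] //= h h'; rewrite (negPf h) (negPf h'). Qed.

Lemma compl_inf_xx a : compl_inf a a = [::].
Proof. by case: a => i /=; rewrite eqxx. Qed.

(** Thus a letter whose node is far from those of [a] and [b] commutes with every letter of their
    complements; see [skew_far]. *)
Lemma compl_inf_node a b l : l \in compl_inf a b -> node l = node a \/ node l = node b.
Proof.
have aux : l \in (if node a == node b then [::]
     else if adjn (node a) (node b) then [:: b; a] else [:: b]) ->
     node l = node a \/ node l = node b.
  by case: ifP => // _; case: ifP => _; rewrite !inE; [case/orP|] => /eqP ->; auto.
case: a b aux => [i|i] [j|j] //= _; case: ifP => // _.
by rewrite inE => /eqP ->; left.
Qed.

Lemma compl_xx x : compl x x = [::].
Proof. by case: x => //= a; rewrite compl_inf_xx. Qed.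

Lemma rel_de_size (u v : seq (gen_de r)) : rel_de e u v -> size u = size v.
Proof. by case=> // {}u {}v; rewrite !size_map; case. Qed.

Lemma rel_inf_compl (u v : seq (gen_inf r)) : rel_inf u v ->
  u = v \/ exists a b, u = a :: compl_inf a b /\ v = b :: compl_inf b a.
Proof.
case=> [i j h|i j h|i j|k i h|j i h].
- right; exists (s_ i), (s_ j); rewrite !compl_inf_far //; move: h; rewrite /adjn /=; lia.
- right; exists (s_ i), (s_ j); rewrite !compl_inf_adj //; move: h; rewrite /adjn /=; lia.
- case: (eqVneq i j) => [->|nij]; first by left.
  by right; exists (t_ i), (t_ j); rewrite /= (negPf nij) eq_sym (negPf nij).
- right; exists (s_ k), (t_ i); rewrite !compl_inf_adj //; move: h; rewrite /adjn /=; lia.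
- right; exists (s_ j), (t_ i); rewrite !compl_inf_far //; move: h; rewrite /adjn /=; lia.
Qed.

Lemma rel_de_compl (u v : seq (gen_de r)) : rel_de e u v ->
  u = v \/ exists x y, u = x :: compl x y /\ v = y :: compl y x.
Proof.
case=> [{}u {}v /rel_inf_compl [->|[a [b [-> ->]]]]|i|j]; first by left.
- by right; exists (inf_ a), (inf_ b).
- right; exists z_, (inf_ (t_ (i - e%:Z)%R)); split=> //=.
  congr [:: _; inf_ (t_ _)]; lia.
- by right; exists z_, (inf_ (s_ j)).
Qed.

Lemma compl_infP a b : pcong (@rel_inf r) (a :: compl_inf a b) (b :: compl_inf b a).
Proof.
have rel u v : rel_inf u v -> pcong (@rel_inf r) u v.
  by move=> h; have := pcong_rel [::] [::] h; rewrite /= !cats0.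
have [eab|nab] := eqVneq (node a) (node b).
  case: (node_eq eab) => [->|[i [j [-> ->]]]]; first exact: pcong_refl.
  rewrite /= [j == i]eq_sym; case: eqP => [->|_]; first exact: pcong_refl.
  exact/rel/rel_tt.
have nba : node b != node a by rewrite eq_sym.
have [ab|ab] := boolP (adjn (node a) (node b)); last first.
  have ba : ~~ adjn (node b) (node a) by rewrite adjn_sym.
  rewrite !compl_inf_far //; case: a b nab nba ab ba => [i|i] [j|j] // nab nba ab ba.
  - apply/pcong_sym/rel/rel_st; have := node_s j; move: nab ab; rewrite /adjn /=; lia.
  - apply/rel/rel_st; have := node_s i; move: nab ab; rewrite /adjn /=; lia.
  - apply/rel/rel_far; move: nab ab; rewrite /adjn /=; lia.
have ba : adjn (node b) (node a) by rewrite adjn_sym.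
rewrite !compl_inf_adj //; case: a b nab nba ab ba => [i|i] [j|j] // nab nba ab ba.
- apply/pcong_sym/rel/rel_s3t; have := node_s j; move: nab ab; rewrite /adjn /=; lia.
- apply/rel/rel_s3t; have := node_s i; move: nab ab; rewrite /adjn /=; lia.
- move: ab; rewrite /adjn => /orP[|] /eqP h; last by apply/rel/rel_braid.
  exact/pcong_sym/rel/rel_braid.
Qed.

Local Notation W := (pword (@rel_de e r)).

Lemma inf_pcong u v : pcong (@rel_inf r) u v ->
  W (map (@inf_ r) u) = W (map (@inf_ r) v).
Proof.
elim=> [a u0 v0 b h|//|//|u0 v0 w _ -> _ -> //].
by rewrite !map_cat !pword_cat (pword_rel (rel_of_inf e h)).
Qed.

Lemma z_compl b : W [:: z_; inf_ (shift e (-1)%R b)] = W [:: inf_ b; z_].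
Proof.
case: b => [i|j]; last exact/pword_rel/rel_zs.
rewrite (pword_rel (rel_zt e r _)); congr (W [:: inf_ (t_ _); z_]); lia.
Qed.

Lemma compl_lcm x y : W (x :: compl x y) = W (y :: compl y x).
Proof.
case: x y => [|a] [|b] //=; [exact: z_compl|exact/esym/z_compl|].
exact: (inf_pcong (compl_infP a b)).
Qed.

Definition shift_de (c : Cinf) (x : gen_de r) : gen_de r :=
  if x is inf_ a then inf_ (shift e c a) else x.

Lemma compl_inf_shift c a b :
  compl_inf (shift e c a) (shift e c b) = map (shift e c) (compl_inf a b).
Proof.
case: a b => [i|i] [j|j] //=; try by case: ifP => //= _; case: ifP.
rewrite (inj_eq (@GRing.addIr _ _)); case: eqP => //= _.
by congr [:: t_ _]; rewrite GRing.addrAC.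
Qed.

Lemma skew_z a b : skew compl z_ (shift_de (-1)%R) (inf_ a) (inf_ b).
Proof.
split; rewrite /= ?compl_inf_shift -?map_comp //.
move=> l; rewrite !inE mem_cat => /or4P[/eqP ->|/eqP ->|/mapP[k _ ->]|/mapP[k _ ->]] //.
Qed.

Lemma skew_far v a b : node v != node a -> ~~ adjn (node v) (node a) ->
  node v != node b -> ~~ adjn (node v) (node b) ->
  skew compl (inf_ v) id (inf_ a) (inf_ b).
Proof.
move=> va va' vb vb'; split; rewrite ?map_id // => l.
have aux k : node k = node a \/ node k = node b ->
    compl (inf_ v) (inf_ k) = [:: inf_ k] /\ compl (inf_ k) (inf_ v) = [:: inf_ v].
  by case=> ek; rewrite /= !compl_inf_far //= ek // 1?adjn_sym // eq_sym.
rewrite !inE mem_cat => /or4P[/eqP ->|/eqP ->|/mapP[k kl ->]|/mapP[k kl ->]];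
  apply: aux; auto; have := compl_inf_node kl; by case; auto.
Qed.

Lemma far_de a b : node a != node b -> ~~ adjn (node a) (node b) ->
  far compl (inf_ a) (inf_ b).
Proof.
by move=> ab ab'; split; rewrite /= compl_inf_far // 1?adjn_sym // eq_sym.
Qed.

Lemma adj_de a b : adjn (node a) (node b) -> adj compl (inf_ a) (inf_ b).
Proof. by move=> ab; split; rewrite /= compl_inf_adj // adjn_sym. Qed.

Local Notation de := (@rel_de e r).

Section Cubes.
Variable n : nat.
Hypothesis lcmn : lcm_below de compl n.

Lemma compl_tt i j : i != j ->
  compl (inf_ (t_ i)) (inf_ (t_ j)) = [:: inf_ (t_ (i - 1)%R)].
Proof. by move=> /negPf /= ->. Qed.

(** Two distinct letters at one node are both some [t_i]; the third letter is then another [t_k], or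
    [s_3], or commutes with both. These cases come first. *)
Lemma cube_inf w x y : x != y -> w != x -> w != y ->
  cube de compl n (inf_ w) (inf_ x) (inf_ y).
Proof.
have S := rel_de_size; have L := compl_lcm; have I := compl_xx.
move=> xy wx wy.
have tt i j : t_ i != t_ j :> gen_inf r -> i != j by apply: contraNN => /eqP ->.
have p_neq (i : int) : i != (i - 1)%R by lia.
have p_inj : injective (fun i : int => (i - 1)%R) by move=> i j; lia.
have st (j : sidx r) : val j = 3 -> forall i, adj compl (inf_ (s_ j)) (inf_ (t_ i)).
  by move=> j3 i; apply: adj_de; rewrite /= j3.
have [ewx|nwx] := eqVneq (node w) (node x).
  case: (node_eq ewx) wx => [->|[i [j [ew ex]]] wx]; first by rewrite eqxx.
  subst w x; have ij := tt _ _ wx.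
  case: y xy wy => [k xy wy|k _ _].
    by apply: (cube_dih S I lcmn compl_tt); apply: tt.
  have [k3|k3] := eqVneq (val k) 3.
    apply: cube_sym.
    by have := @cube_dih_end _ _ _ S L n lcmn _ _ _ _ p_neq compl_tt (st k k3) j i ij.
  apply: cube_sym; apply: (cube_skew_end S L lcmn (s := id)).
  by apply: skew_far => //; have := node_s k; move: k3; rewrite /adjn /=; lia.
have [ewy|nwy] := eqVneq (node w) (node y).
  case: (node_eq ewy) wy => [->|[i [j [ew ey]]] wy]; first by rewrite eqxx.
  subst w y; have ij := tt _ _ wy.
  case: x xy wx nwx => [k _ _|k _ _ _]; first by rewrite eqxx.
  have [k3|k3] := eqVneq (val k) 3.
    by have := @cube_dih_end _ _ _ S L n lcmn _ _ _ _ p_neq compl_tt (st k k3) j i ij.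
  apply: (cube_skew_end S L lcmn (s := id)).
  by apply: skew_far => //; have := node_s k; move: k3; rewrite /adjn /=; lia.
have [exy|nxy] := eqVneq (node x) (node y).
  case: (node_eq exy) xy => [->|[i [j [ex ey]]] xy]; first by rewrite eqxx.
  subst x y; have ij := tt _ _ xy.
  case: w wx wy nwx nwy => [k _ _|k _ _ _ _]; first by rewrite eqxx.
  have [k3|k3] := eqVneq (val k) 3.
    by have := @cube_dih_mid _ _ _ S L I n lcmn _ _ _ _ p_inj compl_tt (st k k3) i j ij.
  apply: (cube_skew_mid S L lcmn (s := id)).
  by apply: skew_far => //; have := node_s k; move: k3; rewrite /adjn /=; lia.
(* Three distinct nodes of a path are consecutive, or one of them is far from the two others. *)
have [wx1|wx1] := boolP (adjn (node w) (node x));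
  have [wy1|wy1] := boolP (adjn (node w) (node y)).
- apply: (cube_path_mid S L I lcmn); [apply: adj_de|apply: adj_de|apply: far_de];
    rewrite // 1?adjn_sym //; move: nwx nwy nxy wx1 wy1; rewrite /adjn; lia.
- have [xy1|xy1] := boolP (adjn (node x) (node y)).
    exact: (cube_path_end S L lcmn (adj_de _) (adj_de _) (far_de _ _)).
  apply: cube_sym; apply: (cube_skew_end S L lcmn (s := id)).
  by apply: skew_far; rewrite // 1?adjn_sym // eq_sym.
- have [xy1|xy1] := boolP (adjn (node x) (node y)).
    apply: cube_sym; apply: (cube_path_end S L lcmn);
      [apply: adj_de|apply: adj_de|apply: far_de]; by rewrite // adjn_sym.
  apply: (cube_skew_end S L lcmn (s := id)).
  by apply: skew_far; rewrite // 1?adjn_sym // eq_sym.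
- by apply: (cube_skew_mid S L lcmn (s := id)); apply: skew_far.
Qed.

Lemma cube_de w x y : x != y -> w != x -> w != y -> cube de compl n w x y.
Proof.
have S := rel_de_size; have L := compl_lcm; have I := compl_xx.
case: w x y => [|w] [|x] [|y] xy wx wy; rewrite ?eqxx // in xy wx wy.
- exact: (cube_skew_mid S L lcmn (skew_z x y)).
- exact: (cube_skew_end S L lcmn (skew_z w y)).
- apply: cube_sym; exact: (cube_skew_end S L lcmn (skew_z w x)).
- by apply: cube_inf; [move: xy|move: wx|move: wy]; apply: contraNN => /eqP ->.
Qed.

End Cubes.
End Compl.

(** * The Garside element *)

Section Lambda.
Variables e r : nat.
Local Notation M := (pres_mon (@rel_de e r)).
Local Notation g := (pgen (@rel_de e r)).
Local Notation W := (pword (@rel_de e r)).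

Local Notation t i := (g (inf_ (t_ i))).
Local Notation z := (g z_).

(* Junk value [1] outside of [3 <= j <= r]. *)
Definition sgen (j : nat) : M := if insub j is Some k then g (inf_ (s_ k)) else 1.
Local Notation s := sgen.

Lemma sgen_val (k : sidx r) : s (val k) = g (inf_ (s_ k)).
Proof. by rewrite /sgen valK. Qed.

Lemma sgen_ind (P : M -> Prop) j :
  P 1 -> (forall k : sidx r, val k = j -> P (g (inf_ (s_ k)))) -> P (s j).
Proof. by move=> P1 Pg; rewrite /sgen; case: insubP => // k _ /Pg. Qed.

Lemma inf_rel (u v : seq (gen_inf r)) :
  rel_inf u v -> W (map (@inf_ r) u) = W (map (@inf_ r) v).
Proof. by move=> h; apply: pword_rel; apply: rel_of_inf. Qed.

Lemma sgen_far i j : i + 2 <= j -> commute (s i) (s j).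
Proof.
move=> ij; elim/sgen_ind: (s i) => [|k ki]; first exact/commute_sym/commute1.
elim/sgen_ind: (s j) => [|l lj]; first exact: commute1.
have := @inf_rel [:: s_ k; s_ l] [:: s_ l; s_ k].
rewrite /= !pword_cons !pword_nil !mulg1; apply; apply: rel_far.
by rewrite ki lj ij.
Qed.

Lemma sgen_braid i : 3 <= i < r -> s i * s i.+1 * s i = s i.+1 * s i * s i.+1.
Proof.
move=> /andP[i3 ir].
have hi : 3 <= i <= r by rewrite i3 ltnW.
have hj : 3 <= i.+1 <= r by rewrite ir ltnW.
have := @inf_rel _ _ (@rel_braid r (Sub i hi) (Sub i.+1 hj) erefl).
by rewrite /= !pword_cons !pword_nil !mulg1 -!sgen_val /= !mulgA.
Qed.

Definition delta : M := t 1%R * t 0%R.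

Lemma deltaE i : t i * t (i - 1)%R = delta.
Proof.
have := inf_rel (rel_tt r i 1%R).
by rewrite /= !pword_cons !pword_nil !mulg1.
Qed.

Lemma sgen_t3 i : 3 <= r -> s 3 * t i * s 3 = t i * s 3 * t i.
Proof.
move=> r3; have h3 : 3 <= 3 <= r by [].
have := inf_rel (@rel_s3t r (Sub 3 h3) i erefl).
by rewrite /= !pword_cons !pword_nil !mulg1 -!sgen_val /= !mulgA.
Qed.

Lemma sgen_t j i : 4 <= j -> commute (s j) (t i).
Proof.
move=> j4; elim/sgen_ind: (s j) => [|k kj]; first exact/commute_sym/commute1.
have := inf_rel (@rel_st r k i _).
by rewrite /= !pword_cons !pword_nil !mulg1 kj; apply.
Qed.

Lemma zt i : z * t i = t (i - e%:Z)%R * z.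
Proof. by have := pword_rel (rel_zt e r i); rewrite !pword_cons !pword_nil !mulg1. Qed.

Lemma zs j : commute z (s j).
Proof.
elim/sgen_ind: (s j) => [|k _]; first exact: commute1.
by have := pword_rel (rel_zs e k); rewrite !pword_cons !pword_nil !mulg1.
Qed.

(** Write [delta] as [t_(i+2) t_(i+1)] on the left and as [t_(i+1) t_i] on the right. *)
Lemma delta_t i : delta * t i = t (i + 2%:Z)%R * delta.
Proof.
rewrite -{1}(deltaE (i + 2%:Z)%R) -(deltaE (i + 1)%R) -mulgA.
by congr (_ * (t _ * t _)); lia.
Qed.

Lemma delta_s j : 4 <= j -> commute (s j) delta.
Proof. by move=> j4; apply: commuteM; apply: sgen_t. Qed.

Lemma delta_z : commute z delta.
Proof.
rewrite /commute /delta mulgA zt -mulgA zt mulgA -/delta -(deltaE (1 - e%:Z)%R).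
by congr (_ * t _ * _); lia.
Qed.

(* The positive analogues of Jucys-Murphy elements: [jm n] is
   [s_(n+2) ... s_3 t_1 t_0 s_3 ... s_(n+2)]. *)
Fixpoint jm n : M := if n is m.+1 then s (m + 3) * jm m * s (m + 3) else delta.

(** The element [s_(n+2) ... s_3 t_1 t_0], whose power of exponent [n + 1] is [Lambda] in rank
    [n + 2]. *)
Fixpoint cox n : M := if n is m.+1 then s (m + 3) * cox m else delta.

(** [Lambda] in rank [n + 2], in the form [jm n ... jm 1 jm 0] that suits commutation arguments;
    [lam_cox] identifies it with the power of [cox n]. *)
Fixpoint lam n : M := if n is m.+1 then jm m.+1 * lam m else delta.

Lemma jmS n : jm n.+1 = s (n + 3) * jm n * s (n + 3). Proof. by []. Qed.

Lemma lamS n : lam n.+1 = jm n.+1 * lam n. Proof. by []. Qed.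

Lemma coxS n : cox n.+1 = s (n + 3) * cox n. Proof. by []. Qed.

Lemma commute_jm n x : commute x delta ->
  (forall j, 3 <= j <= n + 2 -> commute x (s j)) -> commute x (jm n).
Proof.
move=> xd; elim: n => [//|n IHn] xs /=.
have xn : commute x (s (n + 3)) by apply: xs; lia.
by do 2!apply: commuteM => //; apply: IHn => j hj; apply: xs; lia.
Qed.

Lemma commute_cox n x : commute x delta ->
  (forall j, 3 <= j <= n + 2 -> commute x (s j)) -> commute x (cox n).
Proof.
move=> xd; elim: n => [//|n IHn] xs /=.
apply: commuteM; first by apply: xs; lia.
by apply: IHn => j hj; apply: xs; lia.
Qed.

Lemma commute_lam n x : commute x delta ->
  (forall j, 3 <= j <= n + 2 -> commute x (s j)) -> commute x (lam n).
Proof.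
move=> xd; elim: n => [//|n IHn] xs; apply: commuteM.
  exact: commute_jm.
by apply: IHn => j hj; apply: xs; lia.
Qed.

(** For [n = 1], write [delta] as [t_(i+1) t_i] and apply the braid relation of [s_3] with [t_i],
    then with [t_(i+1)]; the further [s_j] commute with all [t_i]. The shift is by one, against two
    for [delta]. *)
Lemma jm_t n i : 0 < n -> n + 2 <= r -> jm n * t i = t (i + 1)%R * jm n.
Proof.
elim: n => [//|[_ _ r3|n IHn _ nr]].
  have ei : (i + 1 - 1)%R = i by lia.
  rewrite /= -(deltaE (i + 1)%R) ei !mulgA.
  have h := sgen_t3 (i + 1)%R r3; have h' := sgen_t3 i r3.
  by rewrite -h -!mulgA; move: h'; rewrite -!mulgA => ->.
have hs k : commute (s (n.+1 + 3)) (t k) by apply: sgen_t; lia.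
have {IHn}: jm n.+1 * t i = t (i + 1)%R * jm n.+1 by apply: IHn; lia.
rewrite (jmS n.+1); move: (jm n.+1) => y ey.
by rewrite -!mulgA hs (mulgA y) ey !mulgA hs.
Qed.

Lemma jm_delta n : 0 < n -> n + 2 <= r -> commute (jm n) delta.
Proof.
move=> n0 nr; rewrite /commute /delta mulgA jm_t // -mulgA jm_t // mulgA.
by rewrite -/delta -(deltaE (1 + 1)%R).
Qed.

Lemma jm_far n j : n + 4 <= j -> commute (s j) (jm n).
Proof.
move=> nj; apply: commute_jm; first by apply: delta_s; lia.
by move=> k hk; apply/commute_sym/sgen_far; lia.
Qed.

Lemma jm_s n j : n + 2 <= r -> 3 <= j <= n + 1 -> commute (jm n) (s j).
Proof.
elim: n => [|n IHn] nr hj; first by lia.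
have [jn|jn] := leqP j (n + 1).
  have c1 : commute (s j) (s (n + 3)) by apply: sgen_far; lia.
  apply: commute_sym; do 2!apply: commuteM => //.
  by apply/commute_sym/IHn; lia.
case: n => [|n] in nr hj jn IHn *; first by lia.
have -> : j = n + 3 by lia.
have h := @sgen_braid (n + 3); rewrite -addSn in h.
have am : commute (s (n.+1 + 3)) (jm n) by apply: jm_far; lia.
(* With these names, [a b y b a b = a b y a b a = a b a y b a = b a b y b a]. *)
rewrite !jmS; move: (s (n.+1 + 3)) (s (n + 3)) (jm n) h am => a b y h am.
have {}h : b * (a * b) = a * (b * a) by rewrite !mulgA; apply: h; lia.
have ht w : b * (a * (b * w)) = a * (b * (a * w)).
  by move: (congr1 ( *%g^~ w) h); rewrite -!mulgA.
by rewrite /commute -!mulgA h (mulgA y a) -am -!mulgA ht.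
Qed.

Lemma jm_jm n : n + 3 <= r -> commute (jm n.+1) (jm n).
Proof.
move=> nr; apply: commute_jm; first by apply: jm_delta; lia.
by move=> j hj; apply: jm_s; lia.
Qed.

Lemma lam_s n j : n + 2 <= r -> 3 <= j <= n + 2 -> commute (lam n) (s j).
Proof.
elim: n => [|n IHn] nr hj; first by lia.
have [jn|jn] := leqP j (n + 2).
  apply/commute_sym; apply: commuteM; apply/commute_sym; last by apply: IHn; lia.
  by apply: jm_s; lia.
have -> : j = n + 3 by lia.
(* With [s] for [s_(n+3)] and [y] for [jm n], [jm_jm] reads [s y s y = y s y s]; hence
   [s (s y s y) = s (y s y s) = (s y s y) s]. *)
have key : commute (s (n + 3)) (jm n.+1 * jm n).
  have h : jm n.+1 * jm n = jm n * jm n.+1 by apply: jm_jm; lia.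
  by rewrite /commute [in LHS]h jmS; move: (jm n) => y; rewrite !mulgA.
apply: commute_sym; case: n => [//|n] in nr hj jn IHn key *.
rewrite lamS mulgA; apply: commuteM => //.
apply: commute_lam; first by apply: delta_s; lia.
by move=> k hk; apply/commute_sym/sgen_far; lia.
Qed.

(** The factor [delta] shifts by two, and each of the [n] other factors by one. *)
Lemma lam_t n i : n + 2 <= r -> lam n * t i = t (i + (n + 2)%:Z)%R * lam n.
Proof.
elim: n i => [|n IHn] i nr; first exact: delta_t.
rewrite lamS -mulgA IHn; last by lia.
rewrite mulgA jm_t // [RHS]mulgA; congr (t _ * _ * _); lia.
Qed.

Lemma lam_z n : commute z (lam n).
Proof. by apply: commute_lam => [|j _]; [exact: delta_z|exact: zs]. Qed.

(** As with Coxeter elements, conjugation moves each [s_j] along the diagram; the top case is a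
    braid relation. *)
Lemma cox_s n j : n + 2 <= r -> 3 <= j <= n + 1 -> cox n * s j.+1 = s j * cox n.
Proof.
elim: n => [|n IHn] nr hj; first by lia.
have [jn|jn] := leqP j (n + 1).
  have c1 : commute (s j) (s (n + 3)) by apply: sgen_far; lia.
  by rewrite /= -mulgA IHn ?mulgA; [rewrite c1|lia|lia].
case: n => [|n] in nr hj jn IHn *; first by lia.
have -> : j = n + 3 by lia.
have := @sgen_braid (n + 3); rewrite /= -addSn.
set a := s (n.+1 + 3); set b := s (n + 3) => h.
have {}h : b * a * b = a * b * a by apply: h; lia.
have am : commute a (cox n).
  apply: commute_cox; first by apply: delta_s; lia.
  by move=> k hk; apply/commute_sym/sgen_far; lia.
by rewrite -!mulgA -am !mulgA h.
Qed.

Lemma prod_iotaSr a m :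
  \prod_(j <- iota a m.+1) s j = \prod_(j <- iota a m) s j * s (a + m).
Proof. by rewrite -[in LHS]addn1 iotaD big_cat /= big_seq1. Qed.

Lemma cox_prod n a m : n + 2 <= r -> 3 <= a -> a + m <= n + 2 ->
  cox n * \prod_(j <- iota a.+1 m) s j = \prod_(j <- iota a m) s j * cox n.
Proof.
elim: m a => [|m IHm] a nr a3 am; first by rewrite !big_nil mul1g mulg1.
rewrite /= !big_cons mulgA cox_s //; last by lia.
by rewrite -mulgA IHm; [rewrite mulgA|lia|lia|lia].
Qed.

(** By [cox_prod], moving a new factor [cox n.+1] to the right lowers the indices of the product by
    one; its own [s_(n+3)] then completes the product. *)
Lemma cox_exp n m : n + 3 <= r -> m <= n.+1 ->
  cox n.+1 ^+ m = \prod_(j <- iota (n + 4 - m) m) s j * cox n ^+ m.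
Proof.
move=> nr; elim: m => [|m IHm] mn; first by rewrite !expg0 big_nil mulg1.
rewrite expgS IHm; last by lia.
have -> : n + 4 - m = (n + 3 - m).+1 by lia.
rewrite mulgA cox_prod; [|lia|lia|lia].
have -> : n + 4 - m.+1 = n + 3 - m by lia.
rewrite prod_iotaSr expgS.
have -> : n + 3 - m + m = n + 3 by lia.
by rewrite !mulgA.
Qed.

Lemma jm_cox n : jm n = cox n * \prod_(j <- iota 3 n) s j.
Proof.
elim: n => [|n IHn]; first by rewrite big_nil mulg1.
by rewrite prod_iotaSr jmS coxS IHn (addnC n) !mulgA.
Qed.

(** Taking [m = n + 1] in [cox_exp] gathers [s_3 ... s_(n+3)] next to one remaining factor
    [cox n.+1], and the two form [jm n.+1]. *)
Lemma lam_cox n : n + 2 <= r -> lam n = cox n ^+ n.+1.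
Proof.
elim: n => [|n IHn] nr; first by rewrite expg1.
rewrite expgS cox_exp; [|lia|by []].
have -> : n + 4 - n.+1 = 3 by lia.
by rewrite mulgA -jm_cox lamS IHn //; lia.
Qed.

Lemma cox_desc n : cox n = \prod_(j <- rev (iota 3 n)) s j * delta.
Proof.
elim: n => [|n IHn]; first by rewrite big_nil mul1g.
rewrite -{2}addn1 iotaD rev_cat big_cat /= big_seq1 addnC -mulgA -IHn.
by [].
Qed.

Lemma Lambda_lam d : 2 <= r -> Lambda d e r = lam (r - 2).
Proof.
move=> r2; rewrite lam_cox; last by lia.
have -> : (r - 2).+1 = r - 1 by lia.
rewrite cox_desc /Lambda; congr ((_ * _) ^+ _).
(* An index out of range is dropped by [pmap insub] and has value [1] under [sgen], so the induction
   works for any list of indices. *)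
rewrite /s_desc; elim: (rev _) => [|j w IHw]; first by rewrite !big_nil.
rewrite big_cons /= {1}/sgen; case: insub => [k|] /=; last by rewrite mul1g.
by rewrite big_cons IHw.
Qed.

Lemma ldivides_lam_s n j : n + 2 <= r -> 3 <= j <= n + 2 -> ldivides (s j) (lam n).
Proof.
elim: n => [|n IHn] nr hj; first by lia.
have [jn|jn] := leqP j (n + 2).
  have [||c ec] := IHn; [lia|lia|].
  exists (jm n.+1 * c); rewrite lamS ec mulgA jm_s; [|lia|lia].
  by rewrite [RHS]mulgA.
have -> : j = n + 3 by lia.
by exists (jm n * s (n + 3) * lam n); rewrite /= !mulgA.
Qed.

Lemma ldivides_lam_t n i : n + 2 <= r -> ldivides (t i) (lam n).
Proof.
elim: n i => [|n IHn] i nr; first by exists (t (i - 1)%R); rewrite deltaE.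
(* The factor [jm n.+1] turns [t_(i-1)] into [t_i]. *)
have [|c ec] := IHn (i - 1)%R; first by lia.
exists (jm n.+1 * c); rewrite lamS ec mulgA jm_t //.
rewrite [RHS]mulgA; congr (t _ * _ * _); lia.
Qed.

Hypothesis r2 : 2 <= r.

Local Notation D := (z * lam (r - 2)).

Lemma D_letter x : exists y, D * g x = g y * D.
Proof.
have zl := lam_z (r - 2).
case: x => [|[i|j]].
- by exists z_; rewrite -mulgA -zl.
- exists (inf_ (t_ (i + (r - 2 + 2)%:Z - e%:Z)%R)).
  by rewrite -mulgA lam_t ?subnK // mulgA zt mulgA.
- exists (inf_ (s_ j)); rewrite -mulgA -sgen_val lam_s; last 2 first.
  + by rewrite subnK.
  + by rewrite subnK //; case: j.
  by rewrite mulgA zs mulgA.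
Qed.

Lemma D_letter' x : exists y, g x * D = D * g y.
Proof.
have zl := lam_z (r - 2).
case: x => [|[i|j]].
- by exists z_; rewrite -mulgA -zl.
- exists (inf_ (t_ (i + e%:Z - (r - 2 + 2)%:Z)%R)).
  rewrite -[RHS]mulgA lam_t ?subnK // !mulgA zt.
  by congr (t _ * _ * _); lia.
- exists (inf_ (s_ j)); rewrite -[RHS]mulgA -sgen_val lam_s; last 2 first.
  + by rewrite subnK.
  + by rewrite subnK //; case: j.
  by rewrite !mulgA zs.
Qed.

Lemma D_left m : exists m', D * m = m' * D.
Proof.
elim/pres_mon_ind: m => [|x m [m' em]]; first by exists 1; rewrite mulg1 mul1g.
have [y ey] := D_letter x; exists (g y * m').
by rewrite [LHS]mulgA ey -[LHS]mulgA em mulgA.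
Qed.

Lemma D_right m : exists m', m * D = D * m'.
Proof.
elim/pres_mon_ind: m => [|x m [m' em]]; first by exists 1; rewrite mulg1 mul1g.
have [y ey] := D_letter' x; exists (g y * m').
by rewrite -[LHS]mulgA em [LHS]mulgA ey -mulgA.
Qed.

Lemma D_atom x : ldivides (g x) D.
Proof.
case: x => [|[i|j]]; first by exists (lam (r - 2)).
(* The index [i + e] is taken back to [i] by [z]. *)
- have [|c ->] := @ldivides_lam_t (r - 2) (i + e%:Z)%R; first by rewrite subnK.
  exists (z * c); rewrite !mulgA zt; congr (t _ * _ * _); lia.
- have [||c ->] := @ldivides_lam_s (r - 2) (val j).
  + by rewrite subnK.
  + by rewrite subnK //; case: j.
  by exists (z * c); rewrite -sgen_val !mulgA zs.
Qed.

Lemma D_gen m : exists2 w : seq M,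
  forall x, x \in w -> ldivides x D & m = \prod_(x <- w) x.
Proof.
exists [seq g x | x <- repr m]; last by rewrite big_map -pword_prod pword_repr.
by move=> _ /mapP[x _ ->]; exact: D_atom.
Qed.

(** * The anti-involution, and the quasi-Garside structure *)

Definition neg_letter (x : gen_de r) : gen_de r :=
  if x is inf_ (t_ i) then inf_ (t_ (- i)%R) else x.

Definition anti_word (u : seq (gen_de r)) := rev (map neg_letter u).

Definition anti (m : M) : M := W (anti_word (repr m)).

Lemma anti_rel u v : rel_de e u v -> W (anti_word u) = W (anti_word v).
Proof.
case=> [_ _ [i j h|i j h|i j|k i h|j i h]|i|j]; rewrite /anti_word /rev /=.
- by apply: (@inf_rel [:: s_ j; s_ i] [:: s_ i; s_ j]); apply: rel_far; rewrite orbC.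
- exact: (inf_rel (rel_braid h)).
(* [t_i t_(i-1)] is sent to [t_(1-i) t_(-i)], which is again of the same form. *)
- have := inf_rel (rel_tt r (1 - i)%R (1 - j)%R); rewrite /= !GRing.opprB.
  have E (k : int) : (1 - k - 1 = - k)%R by lia.
  by rewrite !E.
- exact: (inf_rel (rel_s3t (- i)%R h)).
- exact: esym (inf_rel (rel_st (- i)%R h)).
- rewrite (pword_rel (rel_zt e r (- (i - e%:Z))%R)).
  by congr (W [:: inf_ (t_ _); z_]); lia.
- exact: esym (pword_rel (rel_zs e j)).
Qed.

Lemma anti_pcong u v : pcong (@rel_de e r) u v -> W (anti_word u) = W (anti_word v).
Proof.
elim=> [a u0 v0 b /anti_rel|//|//|u0 v0 w _ -> _ -> //].
by rewrite /anti_word !map_cat !rev_cat !pword_cat => ->.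
Qed.

Lemma anti_wordE u : anti (W u) = W (anti_word u).
Proof. by apply: anti_pcong; apply/pwordP; rewrite pword_repr. Qed.

Lemma antiM a b : anti (a * b) = anti b * anti a.
Proof.
rewrite -(pword_repr a) -(pword_repr b) -pword_cat !anti_wordE.
by rewrite /anti_word map_cat rev_cat pword_cat.
Qed.

Lemma antiK : involutive anti.
Proof.
move=> m; rewrite -(pword_repr m) !anti_wordE /anti_word.
rewrite map_rev revK -map_comp map_id_in // => -[|[i|j]] _ //=.
by rewrite GRing.opprK.
Qed.

Theorem D_quasi_garside_structure :
  quasi_garside_structure (@mon_to_grp _ (@rel_de e r)) D.
Proof.
have lc : right_injective ( *%g : M -> M -> M).
  apply: (pres_lcancel (@rel_de_size e r) (@rel_de_compl e r) (@compl_xx e r)).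
  by move=> n ln w x y; exact: cube_de.
have [_ rc] := anti_cancellative antiM antiK lc.
have gD : garside_element D.
  exact: (quasi_central_garside lc rc D_left D_right D_gen).
have ldl : lattice_order (@ldivides M).
  apply: (ldivides_lattice (@rel_de_size e r) (@rel_de_compl e r) (@compl_xx e r) _
    (@compl_lcm e r)).
    by move=> n ln w x y; exact: cube_de.
  exact: (common_multiple D_right D_gen).
split=> //.
  split; [exact/pres_atomic/rel_de_size|by split| |by exists D].
  by split=> //; exact: (anti_lattice antiM antiK).
have [tau tauP] := choice D_right.
(* Each letter divides [D] on the left, hence also on the right, since [D] is a Garside element. *)
have D_right_atom x : exists y, D = y * g x.
  by case: ((gD.1 (g x)).1 (D_atom x)) => c; exists c.
have [comp compP] := choice D_right_atom.
exact: (fractions lc rc tauP D_left compP).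
Qed.

End Lambda.

(** * Semidirect products *)

Section Semidirect.
Variables (C B : monoidType) (a : monoid_action C B).

Lemma sdpairM c b c' b' :
  sdpair a c b * sdpair a c' b' = sdpair a (c * c') (b * a c b').
Proof. by []. Qed.

Lemma sdpair1_morphism : monoid_morphism (sdpair a 1).
Proof. by split=> // b b'; rewrite sdpairM mul1g mact1. Qed.

Variables (P : monoidType) (phi : P -> semidirect a) (iota : B -> P) (zeta : C -> P).
Hypothesis phi_mor : monoid_morphism phi.
Hypothesis iota_mor : monoid_morphism iota.
Hypothesis zeta_mor : monoid_morphism zeta.
Hypothesis twist : forall c b, zeta c * iota b = iota (a c b) * zeta c.

Definition sd_lift (x : semidirect a) : P := iota x.2 * zeta x.1.

Lemma sd_lift_morphism : monoid_morphism sd_lift.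
Proof.
split=> [|[c b] [c' b']]; rewrite /sd_lift /= ?iota_mor.1 ?zeta_mor.1 ?mul1g //.
by rewrite iota_mor.2 zeta_mor.2 -!mulgA; congr (_ * _); rewrite !mulgA twist.
Qed.

(** [sd_lift] is also a right inverse of [phi], since [(c, b)] is the product of [(1, b)] and
    [(c, 1)]. *)
Lemma semidirect_iso : (forall b, phi (iota b) = sdpair a 1 b) ->
  (forall c, phi (zeta c) = sdpair a c 1) -> cancel phi sd_lift ->
  isomorphism phi.
Proof.
move=> phi_i phi_z phiK; split=> //; exists sd_lift => // -[c b].
rewrite /sd_lift phi_mor.2 phi_i phi_z sdpairM mul1g.
by rewrite (mact_morphism a 1).1 mulg1.
Qed.

End Semidirect.

Section IntPower.
Variables (G : groupType) (x : G).

Definition expgi (n : Cinf) : G :=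
  match (n : int) with Posz m => x ^+ m | Negz m => x ^- m.+1 end.

Lemma expgiS (n : Cinf) : expgi (zC * n) = x * expgi n.
Proof.
case: n => [m|[|m]].
- by rewrite -[zC * _]/(Posz m.+1 : Cinf) /expgi expgS.
- by rewrite -[zC * _]/(Posz 0 : Cinf) /expgi expg1 mulgV.
- have -> : zC * (Negz m.+1 : Cinf) = (Negz m : Cinf).
    by rewrite -[LHS]/((1 + Negz m.+1)%R : int); lia.
  rewrite /expgi.
  by rewrite [x ^+ m.+2]expgSr invgM mulVKg.
Qed.

(** The equivalence in the step allows going down as well as up, and so reaches the negative
    exponents. *)
Lemma Cinf_ind (Q : Cinf -> Prop) :
  Q 1 -> (forall n, Q n <-> Q (zC * n)) -> forall n, Q n.
Proof.
move=> Q1 QS; elim/int_rect => [//|n IHn|n IHn].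
  exact: (QS (Posz n)).1.
apply: (QS _).2; suff -> : zC * ((- (Posz n.+1))%R : Cinf) = (- (Posz n))%R by [].
by rewrite -[LHS]/((1 - (Posz n.+1))%R : int); lia.
Qed.

Lemma expgi_morphism : monoid_morphism expgi.
Proof.
split=> // m n; elim/Cinf_ind: m => [|m]; first by rewrite !mul1g.
rewrite -[zC * m * n]mulgA !expgiS -mulgA; split=> [->//|]; exact: mulgI.
Qed.

End IntPower.

(** * The isomorphisms with the semidirect products *)

Section Iso.
Variables e r : nat.
Local Notation a := (Binf_action e r).
Local Notation ap := (Binfplus_action e r).
Local Notation de := (@rel_de e r).

Lemma shift_zC (i : int) : shift e zC (t_ i : gen_inf r) = t_ (i - e%:Z)%R.
Proof. by rewrite /= [(zC : int)]/(1%R) GRing.mul1r. Qed.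

Lemma gen_semidirect_rel u v : de u v ->
  \prod_(x <- u) gen_semidirect e x = \prod_(x <- v) gen_semidirect e x.
Proof.
have [h1 hM] := sdpair1_morphism a.
case=> [u0 v0 h|i|j].
- have E w : \prod_(x <- map (@inf_ r) w) gen_semidirect e x =
      sdpair a 1 (\prod_(x <- w) pggen (@rel_inf r) x).
    by rewrite big_map; elim: w => [|x w IHw]; rewrite ?big_nil ?h1 // !big_cons IHw hM.
  by rewrite !E (pggen_rel h).
- rewrite !big_cons !big_nil !mulg1 !sdpairM !mul1g !mulg1 [a _ _]act_BinfE shift_zC.
  by rewrite (mact_morphism a 1).1 mulg1.
- rewrite !big_cons !big_nil !mulg1 !sdpairM !mul1g !mulg1 [a _ _]act_BinfE.
  by rewrite (mact_morphism a 1).1 mulg1.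
Qed.

Lemma gen_semidirect_plus_rel u v : de u v ->
  \prod_(x <- u) gen_semidirect_plus e x = \prod_(x <- v) gen_semidirect_plus e x.
Proof.
have [h1 hM] := sdpair1_morphism ap.
case=> [u0 v0 h|i|j].
- have E w : \prod_(x <- map (@inf_ r) w) gen_semidirect_plus e x =
      sdpair ap 1 (\prod_(x <- w) pgen (@rel_inf r) x).
    by rewrite big_map; elim: w => [|x w IHw]; rewrite ?big_nil ?h1 // !big_cons IHw hM.
  by rewrite !E -!pword_prod (pword_rel h).
- rewrite !big_cons !big_nil !mulg1 !sdpairM !mul1g !mulg1 [ap _ _]act_BinfplusE shift_zC.
  by rewrite (mact_morphism ap 1).1 mulg1.
- rewrite !big_cons !big_nil !mulg1 !sdpairM !mul1g !mulg1 [ap _ _]act_BinfplusE.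
  by rewrite (mact_morphism ap 1).1 mulg1.
Qed.

Lemma inf_pgen_rel (u v : seq (gen_inf r)) : rel_inf u v ->
  \prod_(x <- u) pgen de (inf_ x) = \prod_(x <- v) pgen de (inf_ x).
Proof.
move=> h; rewrite -!(big_map (@inf_ r) xpredT) -!pword_prod.
exact/pword_rel/rel_of_inf.
Qed.

Lemma inf_pggen_rel (u v : seq (gen_inf r)) : rel_inf u v ->
  \prod_(x <- u) pggen de (inf_ x) = \prod_(x <- v) pggen de (inf_ x).
Proof.
move=> h; rewrite -!(big_map (@inf_ r) xpredT).
exact/pggen_rel/rel_of_inf.
Qed.

Lemma z_shift x : pgen de z_ * pgen de (inf_ x) = pgen de (inf_ (shift e zC x)) * pgen de z_.
Proof.
have h u v : de u v -> \prod_(x <- u) pgen de x = \prod_(x <- v) pgen de x.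
  by move=> /pword_rel; rewrite !pword_prod.
case: x => [i|j]; last by have := h _ _ (rel_zs e j); rewrite !big_cons !big_nil !mulg1.
by rewrite shift_zC; have := h _ _ (rel_zt e r i); rewrite !big_cons !big_nil !mulg1.
Qed.

Lemma z_shift_grp x :
  pggen de z_ * pggen de (inf_ x) = pggen de (inf_ (shift e zC x)) * pggen de z_.
Proof. by rewrite -!mon_to_grpE -!(mon_to_grp_morphism de).2 z_shift. Qed.

Theorem gen_semidirect_iso : exists2 phi : pres_grp de -> semidirect a,
  isomorphism phi & forall x, phi (pggen de x) = gen_semidirect e x.
Proof.
have phi_mor := pglift_morphism gen_semidirect_rel.
have phiE := pgliftE gen_semidirect_rel.
have iota_mor := pglift_morphism inf_pggen_rel.
have iotaE := pgliftE inf_pggen_rel.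
set phi := pglift _ in phi_mor phiE; set iota := pglift _ in iota_mor iotaE.
pose zeta := expgi (pggen de z_).
have zeta_mor : monoid_morphism zeta by exact: expgi_morphism.
have zetaz c : zeta (zC * c) = pggen de z_ * zeta c by exact: expgiS.
have twist c b : zeta c * iota b = iota (a c b) * zeta c.
  have [i1 iM] := iota_mor; have [ac1 acM] := mact_morphism a c.
  (* For fixed [c], conjugation by [zeta c] and the action of [c] both give morphisms in [b], so it
     suffices to compare them on generators. *)
  apply: (mulIg (zeta c)^-1); rewrite mulgK.
  apply: (pres_grp_ext (f := fun b => zeta c * iota b / zeta c)
    (g := fun b => iota (a c b))).
  - by split=> [|x y]; rewrite ?i1 ?mulg1 ?mulgV // iM !mulgA mulgVK.
  - by split=> [|x y]; rewrite ?ac1 ?i1 // acM iM.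
  - move=> x; rewrite [a _ _]act_BinfE !iotaE; apply: (mulIg (zeta c)).
    rewrite mulgVK; elim/Cinf_ind: c {ac1 acM} x => [x|c].
      by rewrite zeta_mor.1 mul1g mulg1 shift1.
    have E x : pggen de (inf_ (shift e (zC * c) x)) * (pggen de z_ * zeta c) =
        pggen de z_ * (pggen de (inf_ (shift e c x)) * zeta c).
      by rewrite shiftM !mulgA z_shift_grp.
    split=> IHc x; first by rewrite zetaz E -mulgA IHc.
    by apply: (mulgI (pggen de z_)); rewrite -E -zetaz -IHc zetaz mulgA.
exists phi => //; apply: (semidirect_iso phi_mor (iota := iota) (zeta := zeta)).
- apply: (pres_grp_ext (f := fun b => phi (iota b)) (g := sdpair a 1)).
  + exact: comp_monoid_morphism.
  + exact: sdpair1_morphism.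
  + by move=> x; rewrite iotaE phiE.
- elim/Cinf_ind => [|c]; first by rewrite zeta_mor.1 phi_mor.1.
  rewrite zetaz phi_mor.2 phiE /=.
  have -> : sdpair a (zC * c) 1 = sdpair a zC 1 * sdpair a c 1.
    by rewrite sdpairM mul1g (mact_morphism a zC).1.
  by split=> [->//|]; exact: mulgI.
- apply: (pres_grp_ext (f := fun x => sd_lift iota zeta (phi x)) (g := idfun)) => //.
    by apply: comp_monoid_morphism => //; exact: sd_lift_morphism.
  move=> [|x]; rewrite phiE /sd_lift /= ?iota_mor.1 ?zeta_mor.1 ?mul1g ?mulg1 ?iotaE //.
Qed.

Lemma zCX n : zC ^+ n = (Posz n : Cinf).
Proof. by elim: n => [//|n IHn]; rewrite expgS IHn. Qed.

Lemma Cplus_val (c : Cplus) : val c = zC ^+ `|(val c : int)|%N.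
Proof. by case: c => c /= /asboolP[n ->]; rewrite /= !zCX. Qed.

Theorem gen_semidirect_plus_iso : exists2 psi : pres_mon de -> semidirect ap,
  isomorphism psi & forall x, psi (pgen de x) = gen_semidirect_plus e x.
Proof.
have phi_mor := plift_morphism gen_semidirect_plus_rel.
have phiE := pliftE gen_semidirect_plus_rel.
have iota_mor := plift_morphism inf_pgen_rel.
have iotaE := pliftE inf_pgen_rel.
set phi := plift _ in phi_mor phiE; set iota := plift _ in iota_mor iotaE.
(* An element of [Cplus] is a nonnegative integer, so the absolute value loses nothing. *)
pose zeta (c : Cplus) := pgen de z_ ^+ `|(val c : int)|%N.
have zeta_mor : monoid_morphism zeta.
  split=> // c c'; rewrite /zeta -expgnDr; congr (_ ^+ _).
  rewrite -[val (c * c')]/((val c + val c')%R : int).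
  by rewrite (Cplus_val c) (Cplus_val c') !zCX; lia.
have twist c b : zeta c * iota b = iota (ap c b) * zeta c.
  have -> : ap c b = act_Binfplus e (zC ^+ `|(val c : int)|%N) b by rewrite -Cplus_val.
  rewrite /zeta.
  elim: `|_|%N b => [|n IHn] b; first by rewrite mulg1 mul1g act_Binfplus1.
  rewrite !expgS act_BinfplusM -mulgA IHn !mulgA; congr (_ * _).
  elim/pres_mon_ind: (act_Binfplus _ _ b) => [|x m IHm].
    by rewrite (act_Binfplus_morphism e r zC).1 iota_mor.1 mulg1 mul1g.
  rewrite (act_Binfplus_morphism e r zC).2 !iota_mor.2 act_BinfplusE !iotaE.
  by rewrite mulgA z_shift -!mulgA IHm.
exists phi => //; apply: (semidirect_iso phi_mor (iota := iota) (zeta := zeta)).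
- apply: (pres_mon_ext (f := fun b => phi (iota b)) (g := sdpair ap 1)).
  + exact: comp_monoid_morphism.
  + exact: sdpair1_morphism.
  + by move=> x; rewrite iotaE phiE.
- move=> c; rewrite /zeta.
  have {2}-> : c = zCplus ^+ `|(val c : int)|%N.
    apply: val_inj; rewrite [LHS]Cplus_val.
    by elim: `|_|%N => [//|n IHn]; rewrite !expgS IHn.
  elim: `|_|%N => [|n IHn]; first by rewrite phi_mor.1.
  rewrite !expgS phi_mor.2 IHn phiE sdpairM mul1g.
  by rewrite (mact_morphism ap zCplus).1.
- apply: (pres_mon_ext (f := fun x => sd_lift iota zeta (phi x)) (g := idfun)) => //.
    by apply: comp_monoid_morphism => //; exact: sd_lift_morphism.
  move=> [|x]; rewrite phiE /sd_lift /= ?iota_mor.1 ?zeta_mor.1 ?mul1g ?mulg1 ?iotaE //.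
Qed.

End Iso.

Theorem theorem3p15 (d e r : nat) (hd : 2 <= d) (hr : 2 <= r) (he : 1 <= e) :
  [/\ quasi_garside_structure (@Bdeplus_to_Bde d e r)
        (Bdeplus_gen d e z_ * Lambda d e r)%g,
      exists2 phi : Bde d e r -> semidirect (Binf_action e r),
        isomorphism phi &
        forall x, phi (Bde_gen d e x) = gen_semidirect e x
    & exists2 psi : Bdeplus d e r -> semidirect (Binfplus_action e r),
        isomorphism psi &
        forall x, psi (Bdeplus_gen d e x) = gen_semidirect_plus e x].
Proof.
split; last 2 first.
- exact: gen_semidirect_iso.
- exact: gen_semidirect_plus_iso.
rewrite Lambda_lam //; exact: D_quasi_garside_structure.
Qed.
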